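(* Let $g>1$, and fix a Feynman graph $\Gamma$ of genus $g$, a total order $\Omega$ of its vertices, and a tuple $\underline a=(a_1,\dots,a_{3g-3})\in\mathbb{N}^{3g-3}$ (with $0\in\mathbb{N}$). There is a bijection between the set of labeled tropical covers contributing to $N_{\underline a,\Gamma,\Omega}^{\operatorname{trop}}$ and the set $\mathcal{T}_{\underline a,\Gamma,\Omega}$ of tuples contributing to the $q^{2\cdot\underline a}$-coefficient of $I_{\Gamma,\Omega}(q_1,\dots,q_{3g-3})$. The bijection identifies the coefficients $w_k$ of the terms $T_k$ of a tuple with the weights of the edges $q_k$ of the corresponding labeled tropical cover. In particular, the contribution $\prod_k T_k=\prod_k w_k$ of a tuple to the coefficient of $q^{2\cdot\underline a}$ in $I_{\Gamma,\Omega}(q_1,\dots,q_{3g-3})$ equals the multiplicity with which the corresponding labeled tropical cover contributes to $N_{\underline a,\Gamma,\Omega}^{\operatorname{trop}}$.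
   Context: **Feynman graphs.** A Feynman graph $\Gamma$ of genus $g$ is a trivalent connected graph (multiple edges and loops allowed) with first Betti number $g$, equipped with a fixed reference labeling $x_1,\dots,x_{2g-2}$ of its vertices and $q_1,\dots,q_{3g-3}$ of its edges. $q^{2\cdot\underline a}=q_1^{2a_1}\cdots q_{3g-3}^{2a_{3g-3}}$. **Tropical covers.** A tropical curve $C$ is a connected, finite, trivalent metric graph. A tropical elliptic curve $E$ is a circle of fixed length. A map $\pi:C\to E$ is a tropical cover if it is continuous, non-constant, integer affine on each edge, and balanced at every vertex $P$ of $C$: writing $w_e$ (weight of $e$) for the absolute value of the slope of $\pi_{|e}$, and letting $r_1,r_2$ be the two rays of a small neighbourhood $U$ of $\pi(P)$, among the three rays $R$ adjacent to $P$ in the component of $\pi^{-1}(U)$ containing $P$ one has $\sum_{R\mapsto r_1}w_R=\sum_{R\mapsto r_2}w_R$. The degree is the number of preimages of a point $p\in E$ not having a vertex as preimage, counted with the weights of the edges containing them. The branch points are the images of the vertices. A labeled tropical cover $\hat\pi:C\to E$ of type $\Gamma$ is a tropical cover together with a labeling of the vertices and edges of $C$ such that the labeled underlying graph of $C$ is $\Gamma$ with its reference labeling; isomorphisms (isometries of source curves commuting with the maps to $E$) must respect labels, and labeled covers are considered up to isomorphism. **The count.** Fix a base point $p_0\in E$ and points $p_1,\dots,p_{2g-2}\in E$, all pairwise distinct, such that $p_0,p_1,\dots,p_{2g-2}$ appear in this order following the clockwise orientation. Cutting $E$ at $p_0$ and flattening it clockwise to an interval, the vertices of the source of a labeled cover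 are ordered by their image points. $N_{\underline a,\Gamma,\Omega}^{\operatorname{trop}}$ is the number of labeled tropical covers $\hat\pi$ of type $\Gamma$ and degree $\sum_i a_i$, with branch points exactly $p_1,\dots,p_{2g-2}$, with $\#(\hat\pi^{-1}(p_0)\cap q_i)\cdot w_i=a_i$ for all $i$ ($w_i$ the weight of $q_i$), and whose vertex order equals $\Omega$; each is counted with multiplicity $\prod_{k=1}^{3g-3}w_k$. **Refined Feynman integral.** The propagator is $P(z,q):=\frac{1}{4\pi^2}\wp(z,q)+\frac1{12}E_2(q^2)$, where $q=e^{i\pi\tau}$ with $\tau$ in the upper half plane, $\wp(z,q)$ is the Weierstrass $\wp$-function of the lattice $\mathbb{Z}+\mathbb{Z}\tau$, and $E_2(q)=1-24\sum_{d\ge1}\sigma(d)q^d$, $\sigma(d)=\sum_{m\mid d}m$. For an edge $q_k$ connecting $x_i$ and $x_j$ put $P_k:=P(z_i-z_j,q_k)$, with independent variables $q_k=e^{i\pi\tau_k}$. Choose pairwise different small real numbers $y_1,\dots,y_{2g-2}$ ($|y_i-y_j|<\operatorname{Im}\tau_k$ for all $i,j,k$) ordered according to $\Omega$ in the sense that $|e^{-\pi y_i}|<|e^{-\pi y_j}|$ iff $x_i$ precedes $x_j$ in $\Omega$, and paths $\gamma_j:[0,1]\to\mathbb{C}$, $t\mapsto iy_j+t$. Then $I_{\Gamma,\Omega}(q_1,\dots,q_{3g-3}):=\int_{z_j\in\gamma_j}\prod_{k}(-P_k)\,dz_1\cdots dz_{2g-2}$, regarded as a power series in the $q_k$. (If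 $\Gamma$ has a loop edge, set $I_{\Gamma,\Omega}=0$.) **The tuples.** For each edge $q_k$ denote its vertices by $x_{k_1},x_{k_2}$, where, if $a_k=0$, the notation is chosen such that $x_{k_1}$ precedes $x_{k_2}$ in $\Omega$ (so no term is available for a loop edge with $a_k=0$). $\mathcal{T}_{\underline a,\Gamma,\Omega}$ is the set of tuples $\big((a_k,T_k)\big)_{k=1,\dots,3g-3}$ with $T_k=w_k\left(\frac{x_{k_i}}{x_{k_j}}\right)^{2w_k}$, where: if $a_k=0$, then $i=1$, $j=2$ and $w_k\ge1$ is any positive integer; if $a_k\ne0$, then $\{i,j\}=\{1,2\}$ and $w_k$ is a positive divisor of $a_k$; and such that the product $\prod_{k=1}^{3g-3}T_k$ is constant in each $x_i$. Each tuple yields a summand $\prod_kT_k=\prod_kw_k$ of the constant term (in the $x_i$) of $$\prod_{k\mid a_k=0}\Big(\sum_{w_k=1}^\infty w_k\Big(\frac{x_{k_1}}{x_{k_2}}\Big)^{2w_k}\Big)\cdot\prod_{k\mid a_k\ne0}\Big(\sum_{w_k\mid a_k}w_k\Big(\Big(\frac{x_{k_1}}{x_{k_2}}\Big)^{2w_k}+\Big(\frac{x_{k_2}}{x_{k_1}}\Big)^{2w_k}\Big)\Big),$$ and this summand is its contribution to the coefficient of $q^{2\cdot\underline a}$ in $I_{\Gamma,\Omega}$. *)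

(* Defs.v *)
From HB Require Import structures.
From mathcomp Require Import all_boot all_order all_algebra finmap.
From mathcomp Require Import generic_quotient archimedean.
From mathcomp Require Import mathcomp_extra boolp classical_sets functions.
From mathcomp Require Import cardinality reals topology.
Set Implicit Arguments.
Unset Strict Implicit.
Unset Printing Implicit Defensive.
Import Order.TTheory GRing.Theory Num.Theory.
Local Open Scope classical_set_scope.
Local Open Scope ring_scope.
Local Open Scope quotient_scope.

(** * Graphs *)

(* Loops and multiple edges are allowed. The orientation, from [endp e false]
   to [endp e true], is auxiliary: edges are compared through [joins]. *)
Record multigraph (V E : finType) := Multigraph { endp : E -> bool -> V }.

Section Graphs.
Variables (V E : finType) (G : multigraph V E).

Definition joins (e : E) (u v : V) : bool :=
  [exists b, (endp G e b == u) && (endp G e (~~ b) == v)].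

Definition connected_graph : Prop :=
  forall u v : V, connect [rel x y | [exists e, joins e x y]] u v.

(* A flag (e, b) is the half-edge of e at the vertex [endp G e b]; a loop has
   two flags at its vertex. *)
Definition flag_at (h : E * bool) : V := endp G h.1 h.2.

Definition trivalent : Prop :=
  forall v : V, #|[set h | flag_at h == v]%SET| = 3%N.

Definition boundary_mx : 'M[rat]_(#|E|, #|V|) :=
  \matrix_(i, j) ((endp G (enum_val i) true == enum_val j)%:R -
                  (endp G (enum_val i) false == enum_val j)%:R).

(* dim H_1 = dim ker of the cellular boundary map. *)
Definition betti1 : nat := \rank (kermx boundary_mx).

End Graphs.

(* Vertices x_1, .., x_(2g-2) and edges q_1, .., q_(3g-3), indexed from 0. *)
Record feynman_graph (g : nat) := FeynmanGraph {
  fgraph :> multigraph 'I_(2 * g - 2) 'I_(3 * g - 3);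
  fgraph_trivalent : trivalent fgraph;
  fgraph_connected : connected_graph fgraph;
  fgraph_genus : betti1 fgraph = g }.

Definition is_total_order (T : Type) (r : rel T) : Prop :=
  [/\ reflexive r, transitive r, antisymmetric r & total r].

(** * The tropical elliptic curve: a circle of length L *)

Section Circle.
Variables (R : realType) (L : R).

Definition circle_rel : rel R :=
  fun x y => `[< exists k : int, x - y = k%:~R * L >].

Lemma circle_rel_refl : reflexive circle_rel.
Proof. by move=> x; apply/asboolP; exists 0; rewrite subrr mul0r. Qed.

Lemma circle_rel_sym : symmetric circle_rel.
Proof.
move=> x y; apply/asboolP/asboolP => -[k xyk]; exists (- k);
by rewrite mulrNz mulNr -xyk opprB.
Qed.

Lemma circle_rel_trans : transitive circle_rel.
Proof.
move=> y x z /asboolP[k xyk] /asboolP[m yzm]; apply/asboolP; exists (k + m).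
by rewrite mulrzDr mulrDl -xyk -yzm addrA subrK.
Qed.

Canonical circle_equiv :=
  EquivRel circle_rel circle_rel_refl circle_rel_sym circle_rel_trans.

Definition circle := {eq_quot circle_equiv}.

HB.instance Definition _ := Choice.on circle.

(* R / LZ; increasing real parameter is the clockwise direction. *)
Definition circle_proj (t : R) : circle := \pi_({eq_quot circle_equiv}) t.

Lemma circle_projP (s t : R) :
  circle_proj s = circle_proj t <-> exists k : int, s - t = k%:~R * L.
Proof.
split=> [/eqmodP/asboolP //|st]; first by apply/eqmodP/asboolP.
Qed.

(* The open balls of the quotient (arc length) metric. *)
Definition circle_ball (x : circle) (r : R) (y : circle) : Prop :=
  exists s t : R, [/\ x = circle_proj s, y = circle_proj t & `|s - t| < r].

Lemma circle_ball_center x (r : R) : 0 < r -> circle_ball x r x.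
Proof.
by move=> r0; exists (repr x), (repr x); rewrite subrr normr0 /circle_proj reprK.
Qed.

Lemma circle_ball_sym x y (r : R) : circle_ball x r y -> circle_ball y r x.
Proof. by case=> s [t [-> -> st]]; exists t, s; rewrite distrC. Qed.

Lemma circle_ball_triangle x y z (r1 r2 : R) :
  circle_ball x r1 y -> circle_ball y r2 z -> circle_ball x (r1 + r2) z.
Proof.
case=> s [t [-> -> st]] [t' [u [/circle_projP[k tt'] -> t'u]]].
exists s, (u + k%:~R * L); split=> //.
  by apply/circle_projP; exists (- k); rewrite opprD addNKr mulrNz mulNr.
apply: le_lt_trans (ltrD st t'u).
rewrite -tt'; apply: le_trans (ler_normD _ _).
suff -> : s - (u + (t - t')) = s - t + (t' - u) by [].
rewrite !opprD opprK !addrA [RHS]addrAC [in RHS]addrAC.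
by rewrite -!addrA; congr (_ + _); rewrite addrC -addrA addrC.
Qed.

End Circle.

HB.instance Definition _ (R : realType) (L : R) :=
  hasNbhs.Build (circle L) (nbhs_ (entourage_ (@circle_ball R L))).
HB.instance Definition _ (R : realType) (L : R) :=
  Nbhs_isPseudoMetric.Build R (circle L) erefl
    (@circle_ball_center R L) (@circle_ball_sym R L)
    (@circle_ball_triangle R L) erefl.

(* The coordinate in [0, L) of x after cutting the circle at p0 and flattening
   it clockwise (for 0 < L; it does not depend on the representatives). *)
Definition cut_coord (R : realType) (L : R) (p0 x : circle L) : R :=
  let d := repr x - repr p0 in d - (Num.floor (d / L))%:~R * L.

(* p0, p_1, .., p_n are pairwise distinct and in clockwise order. *)
Definition clockwise_ordered (R : realType) (L : R) (n : nat)
    (p0 : circle L) (p : 'I_n -> circle L) : Prop :=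
  (forall i, p i <> p0) /\
  (forall i j : 'I_n, (i < j)%N -> cut_coord p0 (p i) < cut_coord p0 (p j)).

(** * Tropical curves *)

(* Vertices and edges are enumerated, so that tropical curves live in a small
   universe; the enumeration is forgotten by isometries. *)
Record tropical_curve (R : realType) := TropicalCurve {
  nb_vertices : nat;
  nb_edges : nat;
  cgraph :> multigraph 'I_nb_vertices 'I_nb_edges;
  len : 'I_nb_edges -> R;
  len_gt0 : forall e, 0 < len e;
  cgraph_connected : connected_graph cgraph;
  cgraph_trivalent : trivalent cgraph }.

Notation vertex C := 'I_(nb_vertices C).
Notation edge C := 'I_(nb_edges C).

Section CurvePoints.
Variables (R : realType) (C : tropical_curve R).

(* A point is a vertex, or an edge e with a parameter in the open interval
   ]0, len e[. *)
Definition cpoint : Type :=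
  (vertex C + {p : edge C * R | 0 < p.2 < len p.1})%type.

HB.instance Definition _ := Choice.on cpoint.

Definition vpoint (v : vertex C) : cpoint := inl v.

(* The characteristic map [0, len e] -> C of the closed edge e. *)
Definition epoint (e : edge C) (t : R) : cpoint :=
  if insub (e, t) is Some x then inr x else inl (endp C e (0 < t)).

Definition edge_set (e : edge C) : set cpoint :=
  [set epoint e t | t in [set t | 0 <= t <= len e]].

(* [walk x y r]: a path of length r from x to y, made of segments of edges. *)
Inductive walk : cpoint -> cpoint -> R -> Prop :=
| walk_nil x : walk x x 0
| walk_cons e s t y r : 0 <= s <= len e -> 0 <= t <= len e ->
    walk (epoint e t) y r -> walk (epoint e s) y (`|s - t| + r).

Lemma walk_cat x y z r1 r2 : walk x y r1 -> walk y z r2 -> walk x z (r1 + r2).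
Proof.
elim=> [u|e s t u r hs ht _ IH] w2; first by rewrite add0r.
by rewrite -addrA; apply: walk_cons hs ht (IH w2).
Qed.

Lemma walk_sym x y r : walk x y r -> walk y x r.
Proof.
elim=> [u|e s t u r' hs ht _ IH]; first exact: walk_nil.
rewrite addrC -(addr0 (`|s - t|)) distrC; apply: walk_cat IH _.
exact: walk_cons ht hs (walk_nil _).
Qed.

(* The open balls of the path metric. *)
Definition curve_ball (x : cpoint) (r : R) (y : cpoint) : Prop :=
  exists2 d, walk x y d & d < r.

Lemma curve_ball_center x (r : R) : 0 < r -> curve_ball x r x.
Proof. by move=> r0; exists 0 => //; exact: walk_nil. Qed.

Lemma curve_ball_sym x y (r : R) : curve_ball x r y -> curve_ball y r x.
Proof. by case=> d /walk_sym w dr; exists d. Qed.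

Lemma curve_ball_triangle x y z (r1 r2 : R) :
  curve_ball x r1 y -> curve_ball y r2 z -> curve_ball x (r1 + r2) z.
Proof.
case=> d1 w1 h1 [d2 w2 h2]; exists (d1 + d2); first exact: walk_cat w1 w2.
exact: ltrD.
Qed.

End CurvePoints.

Arguments vpoint {R} C v.
Arguments epoint {R} C e t.
Arguments edge_set {R} C e.

HB.instance Definition _ (R : realType) (C : tropical_curve R) :=
  hasNbhs.Build (cpoint C) (nbhs_ (entourage_ (@curve_ball R C))).
HB.instance Definition _ (R : realType) (C : tropical_curve R) :=
  Nbhs_isPseudoMetric.Build R (cpoint C) erefl
    (@curve_ball_center R C) (@curve_ball_sym R C)
    (@curve_ball_triangle R C) erefl.

(* Bijections preserving the path metric, i.e. all of its open balls. *)
Definition curve_isometry (R : realType) (C C' : tropical_curve R)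
    (f : cpoint C -> cpoint C') : Prop :=
  bijective f /\ forall x y (r : R), ball (f x) r (f y) <-> ball x r y.

(** * Tropical covers *)

Section Covers.
Variables (R : realType) (L : R) (C : tropical_curve R).
Variable f : cpoint C -> circle L.

Definition affine_with_slope (e : edge C) (s : int) : Prop :=
  exists c : R, forall t : R, 0 <= t <= len e ->
    f (epoint C e t) = circle_proj L (c + s%:~R * t).

(* The slope in the direction from [endp C e false] to [endp C e true]; it is
   unique because len e and L are nonzero. *)
Definition slope (e : edge C) : int := xget 0 (affine_with_slope e).

Definition weight (e : edge C) : nat := `|slope e|%N.

(* The slope of the ray h in the direction pointing away from its vertex v. The
   ray maps to the clockwise (resp. anticlockwise) ray at f v when this slope is
   positive (resp. negative). *)
Definition ray_slope (h : edge C * bool) : int :=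
  if h.2 then - slope h.1 else slope h.1.

Definition balanced : Prop := forall v : vertex C,
  (\sum_(h | (flag_at C h == v) && (0 < ray_slope h)%R) weight h.1 =
   \sum_(h | (flag_at C h == v) && (ray_slope h < 0)%R) weight h.1)%N.

Definition tropical_cover : Prop :=
  [/\ continuous f,
      exists x y, f x <> f y,
      forall e, exists s, affine_with_slope e s
    & balanced].

(* The number of preimages of p on the edge e; the value is 0 if there are
   infinitely many, which occurs only for an edge contracted to p. *)
Definition edge_count (e : edge C) (p : circle L) : nat :=
  #|` fset_set (edge_set C e `&` f @^-1` [set p]) |.

Definition has_degree (d : nat) : Prop := forall p : circle L,
  (forall v, f (vpoint C v) <> p) ->
  (\sum_(e : edge C) weight e * edge_count e p)%N = d.

End Covers.

Record labeled_cover (R : realType) (L : R) (g : nat) (Gamma : feynman_graph g) :=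
  LabeledCover {
    source : tropical_curve R;
    cmap : cpoint source -> circle L;
    cmap_cover : tropical_cover cmap;
    xlab : 'I_(2 * g - 2) -> vertex source;
    qlab : 'I_(3 * g - 3) -> edge source;
    xlab_bij : bijective xlab;
    qlab_bij : bijective qlab;
    lab_joins : forall k i j,
      joins source (qlab k) (xlab i) (xlab j) = joins Gamma k i j }.

Arguments cmap {R L g Gamma} _ _.

Section Count.
Variables (R : realType) (L : R) (g : nat) (Gamma : feynman_graph g).
Implicit Types c : labeled_cover L Gamma.

Definition cover_iso c c' : Prop :=
  exists phi : cpoint (source c) -> cpoint (source c'),
    [/\ curve_isometry phi,
        forall x, cmap c' (phi x) = cmap c x,
        forall i, phi (vpoint (source c) (xlab c i)) =
                  vpoint (source c') (xlab c' i)
      & forall k, phi @` edge_set (source c) (qlab c k) =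
                  edge_set (source c') (qlab c' k)].

Definition iso_class c : set (labeled_cover L Gamma) := [set c' | cover_iso c c'].

(* The weight w_k of the edge q_k. *)
Definition edge_weight c (k : 'I_(3 * g - 3)) : nat :=
  weight (cmap c) (qlab c k).

Definition multiplicity c : nat := (\prod_(k < 3 * g - 3) edge_weight c k)%N.

Variables (a : 'I_(3 * g - 3) -> nat) (Omega : rel 'I_(2 * g - 2)).
Variables (p0 : circle L) (p : 'I_(2 * g - 2) -> circle L).

Definition contributes c : Prop :=
  [/\ has_degree (cmap c) (\sum_(k < 3 * g - 3) a k)%N,
      range (fun v => cmap c (vpoint (source c) v)) = range p,
      forall k, (edge_count (cmap c) (qlab c k) p0 * edge_weight c k)%N = a k
    & forall i j, Omega i j =
        (cut_coord p0 (cmap c (vpoint (source c) (xlab c i))) <=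
         cut_coord p0 (cmap c (vpoint (source c) (xlab c j))))].

Definition contributing_covers : set (set (labeled_cover L Gamma)) :=
  [set iso_class c | c in contributes].

End Count.

Arguments contributing_covers {R L g} Gamma a Omega p0 p.

(** * Tuples of terms *)

(* The Laurent monomial coef * prod_i x_i ^ (expo i). *)
Record term (n : nat) := Term { coef : nat; expo : {ffun 'I_n -> int} }.

Definition term_one n : term n := Term 1 0.

Definition term_mul n (s t : term n) : term n :=
  Term (coef s * coef t)%N (expo s + expo t).

(* w * (x_i / x_j) ^ (2 w) *)
Definition edge_term n (w : nat) (i j : 'I_n) : term n :=
  Term w [ffun v => (2 * w)%:Z * ((v == i)%:R - (v == j)%:R)].

(* The tuples ((a_k, T_k))_k. *)
Definition term_tuple (g : nat) : Type :=
  {ffun 'I_(3 * g - 3) -> nat * term (2 * g - 2)}.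

Section Tuples.
Variables (g : nat) (Gamma : feynman_graph g).
Variables (a : 'I_(3 * g - 3) -> nat) (Omega : rel 'I_(2 * g - 2)).

Definition available_term (k : 'I_(3 * g - 3)) (T : term (2 * g - 2)) : Prop :=
  exists (i j : 'I_(2 * g - 2)) (w : nat),
    [/\ joins Gamma k i j, T = edge_term w i j, (0 < w)%N
      & if a k == 0%N then Omega i j && (i != j) else (w %| a k)%N].

Definition tuple_prod (t : term_tuple g) : term (2 * g - 2) :=
  \big[@term_mul _/@term_one _]_(k < 3 * g - 3) (t k).2.

Definition tuples : set (term_tuple g) :=
  [set t : term_tuple g |
    [/\ forall k, (t k).1 = a k,
        forall k, available_term k (t k).2
      & forall i, expo (tuple_prod t) i = 0]].

End Tuples.

(* Main.v *)
Require Import Defs.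
From mathcomp Require Import all_boot all_order all_algebra.
From mathcomp Require Import boolp classical_sets functions cardinality.
From mathcomp Require Import reals topology.
From mathcomp Require Import ring lra zify.
Set Implicit Arguments.
Unset Strict Implicit.
Unset Printing Implicit Defensive.
Import Order.TTheory GRing.Theory Num.Theory.
Local Open Scope classical_set_scope.
Local Open Scope ring_scope.

(** Cut the circle at [p0]. In a contributing cover the order [Omega] and the
    set of branch points leave no choice for the image of a vertex [x_i]; let
    [pos i] in ]0, L[ be its coordinate. An edge [q_k] runs clockwise at a
    constant integer speed [w_k] from one of its ends, its tail [x_i], to the
    other, its head [x_j], so that it is described by [w_k], by the pair (tail,
    head) and by the number [N_k] of times that it passes over [p0], and its
    length satisfies

      w_k * len q_k = pos j - pos i + N_k * L,   with   N_k * w_k = a_k.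

    The tuple of the cover has the terms T_k = w_k (x_i / x_j)^(2 w_k). They are
    available: [w_k] divides [a_k], and if [a_k = 0] then [N_k = 0], whence
    [pos i < pos j], since lengths are positive. The exponent of [x_v] in the
    product of the [T_k] is twice the sum of the outgoing slopes at [x_v], so that
    the product is constant if and only if the map is balanced. Contracted edges
    do not occur: distinct vertices have distinct images, so such an edge would
    be a loop, and a loop cancels in the balancing condition at its vertex, which
    forces the third ray to be contracted, hence to be a second loop, in
    contradiction to trivalence ([balanced_loopless]).

    The tuple depends only on the isomorphism class of the cover
    ([cover_tuple_iso]). Weights are metric: near the midpoint of an edge the
    path metric is that of an interval, and the weight is the ratio of distances
    in the target and in the source ([isometry_speed]). Directions are visible in
    the numbers of preimages: by [edge_count_turns], over a point with coordinate
    z the edge [q_k] has [N_k + (pos i < z) - (pos j < z)] points, so that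
    exchanging tail and head changes the count over a point between the two.

    Two covers with the same tuple have equal edge lengths by the formula above,
    and the isomorphism of their graphs given by the labels, which on each edge
    respects the clockwise direction, is an isometry over the circle
    ([cover_tuple_inj]). Conversely, for a tuple give the edge [q_k] of [Gamma]
    the length prescribed by the formula with [N_k = a_k / w_k]; it is positive by
    availability, and letting [q_k] run at speed [w_k] defines a cover
    ([model_contributes]). Its degree is the sum of the [a_k], because the
    corrections in the count of preimages add up to the balancing defects of the
    vertices with [pos v < z], which vanish. *)

(** * Coordinates on the circle *)

Section CircleCoordinates.
Variables (R : realType) (L : R).
Hypothesis hL : 0 < L.

Lemma int_multiple_small (x : R) (k : int) : x = k%:~R * L -> `|x| < L -> x = 0.
Proof.
move=> -> ; rewrite normrM (gtr0_norm hL) -{2}(mul1r L) ltr_pM2r //.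
rewrite -intr_norm -[1]/(1%:~R) ltr_int => k1.
suff -> : k = 0 by rewrite mul0r.
by lia.
Qed.

Lemma circle_proj_shift (s : R) (k : int) :
  circle_proj L (s + k%:~R * L) = circle_proj L s.
Proof. by apply/circle_projP; exists k; ring. Qed.

Lemma cut_coordK (p0 x : circle L) : circle_proj L (repr p0 + cut_coord p0 x) = x.
Proof.
rewrite -[RHS]reprK; apply/circle_projP.
exists (- Num.floor ((repr x - repr p0) / L)); rewrite /cut_coord mulrNz.
by ring.
Qed.

Lemma cut_coord_itv (p0 x : circle L) : 0 <= cut_coord p0 x < L.
Proof.
rewrite /cut_coord; set d := repr x - repr p0.
have := Num.Theory.floor_itv (d / L); rewrite ler_pdivlMr // ltr_pdivrMr //.
by rewrite intrD; move=> /andP[? ?]; apply/andP; split; lra.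
Qed.

Lemma cut_coord_proj (p0 : circle L) (z : R) : 0 <= z < L ->
  cut_coord p0 (circle_proj L (repr p0 + z)) = z.
Proof.
move=> hz; have hc := cut_coord_itv p0 (circle_proj L (repr p0 + z)).
have /circle_projP[k] := cut_coordK p0 (circle_proj L (repr p0 + z)).
set c := cut_coord _ _ in hc *; move=> E.
apply/eqP; rewrite -subr_eq0; apply/eqP/(@int_multiple_small _ k).
  by rewrite -E; ring.
by rewrite ltr_norml; apply/andP; split; lra.
Qed.

Lemma cut_coord_inj (p0 : circle L) : injective (cut_coord p0).
Proof. by move=> x y E; rewrite -(cut_coordK p0 x) E cut_coordK. Qed.

Lemma cut_coord_base (p0 : circle L) : cut_coord p0 p0 = 0.
Proof.
rewrite -[X in cut_coord p0 X](reprK p0) -[repr p0](addr0 _).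
by rewrite cut_coord_proj // lexx.
Qed.

End CircleCoordinates.

(** * Edges of a tropical curve *)

Section EdgePoints.
Variables (R : realType) (C : tropical_curve R).

Lemma epoint_interior (e : edge C) (t : R) (h : 0 < t < len e) :
  epoint C e t = inr (Sub (e, t) h).
Proof. by rewrite /epoint insubT. Qed.

Lemma epoint_left (e : edge C) : epoint C e 0 = vpoint C (endp C e false).
Proof. by rewrite /epoint insubF ?ltxx. Qed.

Lemma epoint_right (e : edge C) : epoint C e (len e) = vpoint C (endp C e true).
Proof. by rewrite /epoint insubF ?len_gt0 //= ltxx andbF. Qed.

Lemma cpointP (x : cpoint C) :
  (exists v, x = vpoint C v) \/ exists e t, 0 < t < len e /\ x = epoint C e t.
Proof.
case: x => [v|[[e t] h]]; first by left; exists v.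
right; exists e, t; split=> //; rewrite (epoint_interior h); congr inr; exact/val_inj.
Qed.

Lemma epoint_inj (e e' : edge C) (t t' : R) : 0 < t < len e ->
  epoint C e t = epoint C e' t' -> e' = e /\ t' = t.
Proof.
move=> h; rewrite (epoint_interior h) /epoint.
case: insubP => //= u hu eu [E].
by move: eu; rewrite -E /= => -[-> ->].
Qed.

Lemma epoint_vpoint (e : edge C) (t : R) (v : vertex C) : 0 < t < len e ->
  epoint C e t <> vpoint C v.
Proof. by move=> h; rewrite (epoint_interior h). Qed.

(** Parametrizes [e] from its end [endp C e b], so that [e] can be traversed in the
    direction in which a cover increases, whatever its auxiliary orientation. *)
Definition opoint (e : edge C) (b : bool) (u : R) : cpoint C :=
  epoint C e (if b then len e - u else u).

Lemma opoint_start (e : edge C) b : opoint e b 0 = vpoint C (endp C e b).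
Proof. by case: b; rewrite /opoint ?subr0 ?epoint_right ?epoint_left. Qed.

Lemma opoint_end (e : edge C) b : opoint e b (len e) = vpoint C (endp C e (~~ b)).
Proof. by case: b; rewrite /opoint ?subrr ?epoint_right ?epoint_left. Qed.

Lemma epointE (e : edge C) b (t : R) :
  epoint C e t = opoint e b (if b then len e - t else t).
Proof. by case: b => //; rewrite /opoint subKr. Qed.

Lemma opoint_inj (e : edge C) b (t t' : R) : 0 < t < len e ->
  opoint e b t = opoint e b t' -> t' = t.
Proof.
rewrite /opoint; case: b => h /epoint_inj[]; lra.
Qed.

End EdgePoints.

Section EdgeMaps.
Variables (R : realType) (L : R).
Hypothesis hL : 0 < L.
Variables (C : tropical_curve R) (f : cpoint C -> circle L).

(** [f] runs clockwise at speed [w] along [e] from the lift [A] of the image of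
    [endp C e b]; unlike a signed slope, this form is independent of the
    auxiliary orientation of [e]. *)
Definition climbs (e : edge C) (b : bool) (w : nat) (A : R) : Prop :=
  forall u, 0 <= u <= len e -> f (opoint e b u) = circle_proj L (A + w%:R * u).

Lemma affine_climbs (e : edge C) (s : int) : affine_with_slope f e s ->
  exists A, climbs e (s < 0) `|s| A.
Proof.
case=> c fE; case: (ltrP s 0) => s0.
  exists (c + s%:~R * len e) => u hu; rewrite /opoint fE; last by lra.
  have -> : (`|s|%N%:R : R) = - s%:~R by rewrite natr_absz ltr0_norm // mulrNz.
  by congr circle_proj; ring.
exists c => u hu; rewrite /opoint fE //.
by rewrite natr_absz ger0_norm.
Qed.

Lemma climbs_affine (e : edge C) b (w : nat) A : climbs e b w A ->
  affine_with_slope f e (if b then - w%:Z else w%:Z).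
Proof.
move=> fE; exists (if b then A + w%:R * len e else A) => t ht.
rewrite (epointE e b) fE; last by case: (b); lra.
by case: b {fE}; congr circle_proj => //; rewrite mulrNz -pmulrn; ring.
Qed.

Lemma climbs_shift (e : edge C) b w A B : climbs e b w A ->
  f (vpoint C (endp C e b)) = circle_proj L B -> climbs e b w B.
Proof.
move=> fE; rewrite -opoint_start fE ?lexx ?ltW ?len_gt0 // mulr0 addr0.
move=> /circle_projP[k kE] u hu; rewrite fE //; apply/circle_projP; exists k.
by rewrite -kE; ring.
Qed.

Lemma slope_unique (e : edge C) (s s' : int) :
  affine_with_slope f e s -> affine_with_slope f e s' -> s = s'.
Proof.
case=> c fE [c' fE']; apply/eqP; rewrite -subr_eq0; apply/eqP; set d := s - s'.
have := fE 0; rewrite fE' ?lexx ?ltW ?len_gt0 // => /(_ isT)/circle_projP[k kE].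
have dE t : 0 <= t <= len e -> exists m : int, d%:~R * t = m%:~R * L.
  move=> ht; have := fE t ht; rewrite fE' // => /circle_projP[m mE].
  exists (k - m); rewrite /d !intrB mulrBl [RHS]mulrBl -kE -mE; ring.
(* a length so short that [d] times it is less than a full turn *)
have l0 := len_gt0 e.
pose t := Num.min (len e) (L / (1 + `|d|%:~R)).
have d0 : 0 <= (`|d|%:~R : R) by rewrite ler0z.
have t0 : 0 < t by rewrite lt_min l0 divr_gt0 //; lra.
have [m mE] : exists m : int, d%:~R * t = m%:~R * L.
  by apply: dE; rewrite ltW // ge_min lexx.
have : d%:~R * t = 0.
  apply: (int_multiple_small hL mE); rewrite normrM (gtr0_norm t0) -intr_norm.
  have tL : t * (1 + `|d|%:~R) <= L.
    by rewrite -ler_pdivlMr ?ge_min ?lexx ?orbT //; lra.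
  by apply: lt_le_trans tL; rewrite mulrDr mulr1 mulrC ltrDr.
by move/eqP; rewrite mulf_eq0 (gt_eqF t0) orbF intr_eq0 => /eqP.
Qed.

Lemma slopeE (e : edge C) s : affine_with_slope f e s -> slope f e = s.
Proof.
by move=> h; apply: slope_unique (h); exact: (xgetI 0 h).
Qed.

Lemma slope_affine (e : edge C) : (exists s, affine_with_slope f e s) ->
  affine_with_slope f e (slope f e).
Proof. by case=> s h; rewrite (slopeE h). Qed.

Lemma climbs_slope (e : edge C) b w A : climbs e b w A ->
  slope f e = if b then - w%:Z else w%:Z.
Proof. by move/climbs_affine/slopeE. Qed.

Lemma climbs_weight (e : edge C) b w A : climbs e b w A -> weight f e = w.
Proof. by move/climbs_slope; rewrite /weight => ->; case: b; rewrite ?abszN. Qed.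

(** The points of the edge over [circle_proj L z] correspond to the integers [m]
    such that [z + m L] lies between the lifts of the images of the two ends. *)
Lemma edge_fiber (e : edge C) b w A z : (0 < w)%N -> climbs e b w A ->
  circle_proj L z <> circle_proj L A ->
  circle_proj L z <> circle_proj L (A + w%:R * len e) ->
  exists2 n : nat,
    n%:Z = Num.floor ((A + w%:R * len e - z) / L) - Num.floor ((A - z) / L)
  & (edge_set C e `&` f @^-1` [set circle_proj L z] #= `I_n)%card.
Proof.
move=> w0 fE zA zB.
set m1 := Num.floor ((A + _ - z) / L); set m0 := Num.floor ((A - z) / L).
have W0 : 0 < w%:R :> R by rewrite ltr0n.
have l0 := len_gt0 e.
have wl0 : 0 < w%:R * len e by rewrite mulr_gt0.
have m01 : m0 <= m1 by apply: le_floor; rewrite ler_pM2r ?invr_gt0 //; lra.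
exists `|m1 - m0|%N; first by lia.
(* the parameters of the preimages, over the lifts [z + m L] with [m0 < m <= m1] *)
pose tau (i : nat) : R := (z + (m0 + 1 + i%:Z)%:~R * L - A) / w%:R.
have tauE i : w%:R * tau i = z + (m0 + 1 + i%:Z)%:~R * L - A.
  by rewrite /tau mulrC divfK ?gt_eqF.
have tau_itv i : (i < `|m1 - m0|)%N -> 0 < tau i < len e.
  move=> hi; rewrite -(ltr_pM2l W0) mulr0 -(ltr_pM2l W0 _ (len e)) tauE.
  have h0 : (A - z) / L < (m0 + 1 + i%:Z)%:~R.
    apply: lt_le_trans (floorD1_gt _) _; rewrite ler_int -/m0; lia.
  have h1 : (m0 + 1 + i%:Z)%:~R <= (A + w%:R * len e - z) / L.
    by rewrite -floor_ge_int -/m1; lia.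
  rewrite ltr_pdivrMr // in h0; rewrite ler_pdivlMr // in h1.
  apply/andP; split; first by lra.
  rewrite lt_neqAle; apply/andP; split; last by lra.
  apply/eqP => E; apply: zB; apply/circle_projP; exists (- (m0 + 1 + i%:Z)).
  by rewrite mulrNz mulNr; lra.
have -> : edge_set C e `&` f @^-1` [set circle_proj L z] =
          [set opoint e b (tau i) | i in `I_(`|m1 - m0|%N)].
  apply/seteqP; split=> x /=.
    case=> -[t] /= ht <-; set u := if b then len e - t else t.
    have hu : 0 <= u <= len e by rewrite /u; case: (b); lra.
    rewrite (epointE e b) -/u fE // => /circle_projP[k kE].
    have k0 : m0 < k.
      rewrite /m0 floor_lt_int ltr_pdivrMr // -kE.
      suff : 0 < w%:R * u by lra.
      rewrite mulr_gt0 // lt_neqAle; case/andP: (hu) => -> _; rewrite andbT.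
      apply/eqP => u0; apply: zA; apply/circle_projP; exists (- k).
      by rewrite mulrNz mulNr -kE -u0 mulr0; ring.
    have k1 : k <= m1.
      rewrite /m1 floor_ge_int ler_pdivlMr // -kE.
      have : w%:R * u <= w%:R * len e by rewrite ler_pM2l //; case/andP: hu.
      by lra.
    exists `|(k - m0 - 1)%R|%N; first by lia.
    congr opoint; apply: (mulfI (lt0r_neq0 W0)); rewrite tauE.
    have -> : m0 + 1 + `|(k - m0 - 1)%R|%N%:Z = k by lia.
    by rewrite -kE; ring.
  case=> i hi <-; have /andP[h0 h1] := tau_itv i hi.
  have hu : 0 <= tau i <= len e by rewrite !ltW.
  split; first by exists (if b then len e - tau i else tau i) => //=; case: (b); lra.
  rewrite /= fE // tauE; apply/circle_projP; exists (m0 + 1 + i%:Z).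
  by ring.
apply: inj_card_eq => i j; rewrite !inE => hi hj E.
have := opoint_inj (tau_itv i hi) E.
move/(congr1 ( *%R w%:R)); rewrite !tauE => /addIr/addrI/(mulIf (lt0r_neq0 hL)).
by move/eqP; rewrite eqr_int => /eqP; lia.
Qed.

(** Each of the [N] full turns passes once over every point of the circle; the
    remaining arc from [P] to [Q], counted with its direction, only concerns the
    points between [P] and [Q]. *)
Lemma edge_count_turns (e : edge C) b w r P Q z (N : int) :
  (0 < w)%N -> climbs e b w (r + P) -> w%:R * len e = Q - P + N%:~R * L ->
  0 <= P < L -> 0 <= Q < L -> 0 <= z < L -> z != P -> z != Q ->
  (edge_count f e (circle_proj L (r + z)))%:Z = N + (P < z)%R%:Z - (Q < z)%R%:Z.
Proof.
move=> w0 fE lE hP hQ hz zP zQ.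
have neq a c : 0 <= a < L -> 0 <= c < L -> a != c ->
    circle_proj L (r + a) <> circle_proj L (r + c).
  move=> ha hc ac /circle_projP[k kE]; case/eqP: ac; apply/eqP.
  rewrite -subr_eq0; apply/eqP/(int_multiple_small hL (k := k)); first by lra.
  by rewrite ltr_norml; apply/andP; split; lra.
have endE : r + P + w%:R * len e = (r + Q) + N%:~R * L by rewrite lE; ring.
have [||n nE card_n] := @edge_fiber e b w (r + P) (r + z) w0 fE.
- exact: neq.
- by rewrite endE circle_proj_shift; exact: neq.
rewrite /edge_count (card_fset_set card_n) nE endE.
have small a : 0 <= a < L ->
    Num.floor ((r + a - (r + z)) / L) = - (a < z)%R%:Z.
  move=> ha; apply: floor_def; rewrite ler_pdivlMr // ltr_pdivrMr //.
  by case: ltrP => az /=; rewrite ?mulN1r ?mulr0z ?mulr1z ?oppr0 ?add0r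
    ?addNr ?mul0r ?mul1r; rewrite ?mulrNz ?mulN1r; apply/andP; split; lra.
rewrite (small P) //.
have -> : (r + Q + N%:~R * L - (r + z)) / L = (r + Q - (r + z)) / L + N%:~R.
  by field; rewrite gt_eqF.
rewrite floorDrz ?intr_int // small // intrKfloor. by ring.
Qed.

End EdgeMaps.

(** * The path metric *)

Section PathMetric.
Variables (R : realType) (C : tropical_curve R).

(** The distance from the point [s] of [e], truncated at [d] so as to be constant
    outside [e]. It is a 1-Lipschitz function for the path metric, which bounds
    the lengths of walks from below. *)
Definition truncated_dist (e : edge C) (s d : R) (x : cpoint C) : R :=
  if x is inr p then
    if (val p).1 == e then Num.min `|s - (val p).2| d else d
  else d.

Lemma truncated_dist_on (e : edge C) (s d t : R) :
  d <= s -> d <= len e - s -> 0 <= t <= len e ->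
  truncated_dist e s d (epoint C e t) = Num.min `|s - t| d.
Proof.
move=> ds dl ht; have l0 := len_gt0 e.
have [t0|t0] := eqVneq t 0.
  rewrite t0 epoint_left /= min_r // subr0; exact: le_trans ds (ler_norm _).
have [tl|tl] := eqVneq t (len e).
  rewrite tl epoint_right /= min_r // distrC; exact: le_trans dl (ler_norm _).
have hi : 0 < t < len e by rewrite !lt_neqAle eq_sym t0 tl; lra.
by rewrite (epoint_interior hi) /= eqxx.
Qed.

Lemma truncated_dist_off (e e' : edge C) (s d t : R) : e' != e ->
  truncated_dist e s d (epoint C e' t) = d.
Proof.
move=> ee'; rewrite /epoint; case: insubP => //= u hu eu.
by move: (congr1 fst eu) => /= ->; rewrite (negbTE ee').
Qed.

Lemma truncated_dist_walk (e : edge C) (s d r : R) (x y : cpoint C) :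
  d <= s -> d <= len e - s -> walk x y r ->
  truncated_dist e s d y <= truncated_dist e s d x + r.
Proof.
move=> ds dl; elim=> [u|e' a b z r' ha hb _ IH]; first by rewrite addr0.
apply: le_trans IH _; rewrite addrA lerD2r.
have [E|ee'] := eqVneq e' e; last by rewrite !truncated_dist_off // lerDl.
rewrite E in ha hb *.
rewrite !truncated_dist_on //.
have := ler_distD a s b; set p := `|s - b|; set q := `|s - a|.
case: (leP p d); case: (leP q d); have := normr_ge0 (a - b); lra.
Qed.

(** A walk that is shorter than the segment has to leave the edge, and is then at
    least as long as the distance from [s] to the nearest end. *)
Lemma walk_segment_le (e : edge C) (s t r : R) :
  0 < s < len e -> 0 <= t <= len e ->
  walk (epoint C e s) (epoint C e t) r ->
  Num.min `|s - t| (Num.min s (len e - s)) <= r.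
Proof.
move=> hs ht w; have /andP[s0 sl] := hs.
set d := Num.min s (len e - s).
have ds : d <= s by rewrite ge_min lexx.
have dl : d <= len e - s by rewrite ge_min lexx orbT.
have d0 : 0 < d by rewrite lt_min s0 subr_gt0.
have := truncated_dist_walk ds dl w.
rewrite !truncated_dist_on ?(ltW s0) ?(ltW sl) //.
by rewrite subrr normr0 (min_l (ltW d0)) add0r.
Qed.

Lemma walk_segment (e : edge C) (s t : R) :
  0 <= s <= len e -> 0 <= t <= len e -> 
  walk (epoint C e s) (epoint C e t) `|s - t|.
Proof.
by move=> hs ht; rewrite -[X in walk _ _ X]addr0; exact: walk_cons hs ht (walk_nil _).
Qed.

End PathMetric.

(** * Maps between tropical curves *)

Section CurveMaps.
Variables (R : realType) (C C' : tropical_curve R).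

Section GraphMorphism.
Variables (xv : vertex C -> vertex C') (xe : edge C -> edge C').
Variable (flip : edge C -> bool).
Hypothesis len_xe : forall e, len (xe e) = len e.
Hypothesis endp_xe : forall e b, endp C' (xe e) (b (+) flip e) = xv (endp C e b).

Definition graph_map (x : cpoint C) : cpoint C' :=
  match x with
  | inl v => vpoint C' (xv v)
  | inr p => opoint (xe (val p).1) (flip (val p).1) (val p).2
  end.

Lemma graph_map_epoint (e : edge C) (t : R) : 0 <= t <= len e ->
  graph_map (epoint C e t) = opoint (xe e) (flip e) t.
Proof.
move=> ht; have [t0|t0] := eqVneq t 0.
  by rewrite t0 epoint_left opoint_start /= -endp_xe.
have [tl|tl] := eqVneq t (len e).
  by rewrite tl epoint_right -len_xe opoint_end /= -endp_xe.
have hi : 0 < t < len e by rewrite !lt_neqAle eq_sym t0 tl; lra.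
by rewrite (epoint_interior hi).
Qed.

Lemma graph_map_walk (x y : cpoint C) (r : R) :
  walk x y r -> walk (graph_map x) (graph_map y) r.
Proof.
elim=> [u|e s t z r' hs ht _]; first exact: walk_nil.
rewrite !graph_map_epoint // /opoint => IH.
have lE := len_xe e.
have -> : `|s - t| = `|(if flip e then len (xe e) - s else s) -
                      (if flip e then len (xe e) - t else t)|.
  by case: (flip e) => //; rewrite distrC; congr `|_|; ring.
by apply: walk_cons IH; case: (flip e); lra.
Qed.

End GraphMorphism.
End CurveMaps.

Lemma graph_mapK (R : realType) (C C' : tropical_curve R)
    (xv : vertex C -> vertex C') (xe : edge C -> edge C') flip
    (yv : vertex C' -> vertex C) (ye : edge C' -> edge C) :
  (forall e, len (xe e) = len e) -> (forall e, len (ye e) = len e) ->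
  (forall e b, endp C' (xe e) (b (+) flip e) = xv (endp C e b)) ->
  (forall e b, endp C (ye e) (b (+) flip (ye e)) = yv (endp C' e b)) ->
  cancel xv yv -> cancel xe ye ->
  cancel (graph_map xv xe flip) (graph_map yv ye (flip \o ye)).
Proof.
move=> lx ly ex ey xvK xeK x.
have [[v ->]|[e [t [ht ->]]]] := cpointP x; first by rewrite /= xvK.
have ht' : 0 <= t <= len e by lra.
have lE := lx e.
rewrite graph_map_epoint // {1}/opoint graph_map_epoint //; last first.
  by case: (flip e); lra.
by rewrite /= xeK /opoint; case: (flip e) => //; rewrite lE subKr.
Qed.

(** The map and its inverse send walks to walks of the same length. *)
Lemma graph_map_isometry (R : realType) (C C' : tropical_curve R)
    (xv : vertex C -> vertex C') (xe : edge C -> edge C') flip :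
  bijective xv -> bijective xe ->
  (forall e, len (xe e) = len e) ->
  (forall e b, endp C' (xe e) (b (+) flip e) = xv (endp C e b)) ->
  curve_isometry (graph_map xv xe flip).
Proof.
move=> [yv xvK yvK] [ye xeK yeK] lx ex.
have ly e : len (ye e) = len e by rewrite -lx yeK.
have ey e b : endp C (ye e) (b (+) flip (ye e)) = yv (endp C' e b).
  by apply: (can_inj xvK); rewrite yvK -ex yeK addbK.
pose psi := graph_map yv ye (flip \o ye).
have phiK : cancel (graph_map xv xe flip) psi by exact: graph_mapK.
have psiK : cancel psi (graph_map xv xe flip).
  have := @graph_mapK _ _ _ yv ye (flip \o ye) xv xe ly lx ey.
  have -> : (flip \o ye) \o xe = flip by apply/funext => e /=; rewrite xeK.
  apply => // e b /=; rewrite ?xeK; exact: ex.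
split; first by exists psi.
move=> x y r; split=> -[d w dr]; exists d => //; last first.
  exact: graph_map_walk w.
by rewrite -(phiK x) -(phiK y); exact: graph_map_walk w.
Qed.

Section EdgeIsometry.
Variables (R : realType) (L : R).
Hypothesis hL : 0 < L.
Variables (C C' : tropical_curve R).
Variables (f : cpoint C -> circle L) (f' : cpoint C' -> circle L).
Variable phi : cpoint C -> cpoint C'.
Hypothesis phi_iso : curve_isometry phi.
Hypothesis fphi : forall x, f' (phi x) = f x.
Variables (e : edge C) (e' : edge C').
Hypothesis phi_edge : phi @` edge_set C e = edge_set C' e'.

Lemma isometry_edge_count (z : circle L) : edge_count f' e' z = edge_count f e z.
Proof.
have phi_inj : injective phi by case: phi_iso => /bij_inj.
have E : edge_set C' e' `&` f' @^-1` [set z] =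
         phi @` (edge_set C e `&` f @^-1` [set z]).
  rewrite -phi_edge; apply/seteqP; split=> x /=.
    by case=> -[y ye <-] yz; exists y => //; split=> //=; rewrite -fphi.
  by case=> y [ye yz] <-; split; [exists y | rewrite fphi].
have cE := @inj_card_eq _ _ (edge_set C e `&` f @^-1` [set z]) phi (in2W phi_inj).
rewrite /edge_count E; have [fin|infin] := pselect (finite_set (edge_set C e `&` f @^-1` [set z])).
  by apply/fcard_eq => //; exact: finite_image.
have infin' := infin; rewrite -(eq_finite_set cE) in infin'.
by rewrite /fset_set; do 2 case: pselect => //.
Qed.

Hypothesis phi_vertex : forall v', exists v, phi (vpoint C v) = vpoint C' v'.

(** Near the midpoint of an edge the path metric is the metric of an interval,
    and [phi] preserves it, so that both maps move by the same distance on the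
    circle when the point moves by a small [h]. *)
Lemma isometry_speed (s s' : int) :
  affine_with_slope f e s -> affine_with_slope f' e' s' -> `|s|%N = `|s'|%N.
Proof.
case: phi_iso => /bij_inj phi_inj phi_ball [c fE] [c' fE'].
have l0 := len_gt0 e; pose m := len e / 2.
have hm : 0 < m < len e by rewrite /m; lra.
have onto t : 0 <= t <= len e ->
    exists2 t', 0 <= t' <= len e' & phi (epoint C e t) = epoint C' e' t'.
  move=> ht; have : edge_set C' e' (phi (epoint C e t)).
    by rewrite -phi_edge; exists (epoint C e t) => //; exists t.
  by case=> t' ht' <-; exists t'.
have [m' hm' mE] : exists2 m', 0 < m' < len e' & phi (epoint C e m) = epoint C' e' m'.
  have [|m' hm' mE] := onto m; first by lra.
  have nv v' : epoint C' e' m' <> vpoint C' v'.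
    rewrite -mE => E; have [v vE] := phi_vertex v'.
    by move: E; rewrite -vE => /phi_inj; exact: epoint_vpoint.
  exists m' => //; rewrite !lt_neqAle; case/andP: hm' => -> ->; rewrite !andbT.
  apply/andP; split; apply/eqP => E.
    by apply: (nv (endp C' e' false)); rewrite -E epoint_left.
  by apply: (nv (endp C' e' true)); rewrite E epoint_right.
pose D := Num.min m' (len e' - m').
pose B := L / (2 + `|s|%:~R + `|s'|%:~R).
have a0 : 0 <= (`|s|%:~R : R) by rewrite ler0z.
have a0' : 0 <= (`|s'|%:~R : R) by rewrite ler0z.
have B0 : 0 < B by rewrite divr_gt0 //; lra.
have D0 : 0 < D by rewrite lt_min; lra.
(* [h] keeps both segments inside their edges and both images within less than
   a full turn *)
pose h := Num.min (m / 2) (Num.min (D / 2) (B / 2)).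
have h0 : 0 < h by rewrite !lt_min; apply/and3P; split; lra.
have hm2 : h <= m / 2 by rewrite ge_min lexx.
have hD2 : h <= D / 2 by rewrite !ge_min lexx orbT.
have hB2 : h <= B / 2 by rewrite !ge_min lexx !orbT.
have [|t' ht' tE] := onto (m + h); first by rewrite /m in hm2 *; lra.
have dist_h : `|m - (m + h)| = h by rewrite opprD addNKr normrN gtr0_norm.
have near_le r : h < r -> Num.min `|m' - t'| D <= r.
  move=> hr; have : ball (epoint C e m) r (epoint C e (m + h)).
    exists h => //; rewrite -[X in walk _ _ X]dist_h; apply: walk_segment; rewrite /m in hm2 *; lra.
  rewrite -phi_ball mE tE => -[d w dr]; apply: le_trans (ltW dr).
  exact: walk_segment_le w.
have near_ge r : `|m' - t'| < r -> h <= r.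
  move=> hr; have : ball (epoint C' e' m') r (epoint C' e' t').
    by exists `|m' - t'| => //; apply: walk_segment => //; lra.
  rewrite -mE -tE phi_ball => -[d w dr]; apply: le_trans (ltW dr).
  have := walk_segment_le hm _ w; rewrite dist_h.
  have -> : len e - m = m by rewrite /m; lra.
  rewrite minxx min_l; last by lra.
  by apply; rewrite /m in hm2 *; lra.
have hle : h <= `|m' - t'|.
  by apply/ler_addgt0Pl => r r0; apply: near_ge; lra.
have hge : `|m' - t'| <= h.
  have : Num.min `|m' - t'| D <= h.
    by apply/ler_addgt0Pl => r r0; apply: near_le; lra.
  by rewrite ge_min => /orP[//|]; lra.
have dist_h' : `|t' - m'| = h by apply/eqP; rewrite distrC eq_le hge hle.
have [k kE] : exists k : int, s%:~R * h - s'%:~R * (t' - m') = k%:~R * L.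
  have /circle_projP[k0 k0E] : circle_proj L (c + s%:~R * m) = circle_proj L (c' + s'%:~R * m').
    by rewrite -(fE m) -?(fE' m') -?mE ?fphi //; lra.
  have /circle_projP[k1 k1E] : circle_proj L (c + s%:~R * (m + h)) = circle_proj L (c' + s'%:~R * t').
    by rewrite -(fE (m + h)) -?(fE' t') -?tE ?fphi //; rewrite /m in hm2 *; lra.
  by exists (k1 - k0); rewrite intrB mulrBl -k1E -k0E; ring.
have : s%:~R * h - s'%:~R * (t' - m') = 0.
  apply: (int_multiple_small hL kE).
  apply: le_lt_trans (ler_normB _ _) _.
  rewrite !normrM dist_h' (gtr0_norm h0) -!intr_norm -mulrDl.
  have : B * (2 + `|s|%:~R + `|s'|%:~R) = L by rewrite divfK // gt_eqF //; lra.
  set S := _ + `|s'|%:~R => BE.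
  have : h * S <= B / 2 * S by rewrite ler_wpM2r // /S; lra.
  have : (`|s|%:~R + `|s'|%:~R) * h <= S * h by rewrite ler_wpM2r ?(ltW h0) // /S; lra.
  rewrite [h * S]mulrC [B / 2 * S]mulrAC BE => h1 h2.
  by apply: le_lt_trans (le_trans h1 h2) _; rewrite ltr_pdivrMr // mulr_natr ltr_pwDr.
move/eqP; rewrite subr_eq0 => /eqP/(congr1 Num.norm).
rewrite !normrM dist_h' (gtr0_norm h0) => /(mulIf (lt0r_neq0 h0)).
by rewrite -!intr_norm => /eqP; rewrite eqr_int => /eqP; rewrite -!abszE => -[].
Qed.

End EdgeIsometry.

(** An edgewise affine map is Lipschitz, because a walk has finitely many steps
    and each of them is contained in one edge. *)
Lemma edgewise_affine_continuous (R : realType) (L : R) (hL : 0 < L) (C : tropical_curve R)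
    (f : cpoint C -> circle L) :
  (forall e, exists s, affine_with_slope f e s) -> continuous f.
Proof.
move=> aff; pose K : R := 1 + \sum_(e : edge C) `|slope f e|%:~R.
have K1 : 1 <= K by rewrite lerDl sumr_ge0 // => e _; rewrite ler0z.
have lip x y r : walk x y r -> forall s, f x = circle_proj L s ->
    exists2 t, f y = circle_proj L t & `|s - t| <= K * r.
  elim=> [u s us|e a b z r' ha hb _ IH s].
    by exists s => //; rewrite subrr normr0 mulr0.
  have [c fE] := slope_affine hL (aff e).
  rewrite fE // => /circle_projP[k kE].
  set s' := s + (slope f e)%:~R * (b - a).
  have [|t tE tr] := IH s'.
    by rewrite fE //; apply/circle_projP; exists k; rewrite -kE /s'; ring.
  exists t => //; apply: le_trans (ler_distD s' _ _) _.
  rewrite mulrDr; apply: lerD => //.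
  rewrite opprD addNKr normrN normrM distrC ler_wpM2r //.
  rewrite /K (bigD1 e) //= -intr_norm addrCA lerDl addr_ge0 //.
  by rewrite sumr_ge0 // => i _; rewrite ler0z.
move=> x; apply/(@cvg_ballP _ _ _ (nbhs x) (nbhs_filter x)) => eps eps0.
have K0 : 0 < K by lra.
apply/nbhs_ballP; exists (eps / K); first by rewrite /= divr_gt0.
move=> y [d w dr].
have [t tE tr] := lip x y d w _ (esym (reprK (f x))).
exists (repr (f x)), t; split => //; first by rewrite /circle_proj reprK.
by apply: le_lt_trans tr _; rewrite mulrC -ltr_pdivlMr.
Qed.

(** * Finite total orders *)

Section OrderRank.
Variables (n : nat) (Omega : rel 'I_n).
Hypothesis hOmega : is_total_order Omega.

Definition order_rank_nat (i : 'I_n) : nat :=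
  #|[set j | Omega j i && (j != i)]%SET|.

Lemma order_rank_lt (i : 'I_n) : (order_rank_nat i < n)%N.
Proof.
rewrite -[X in (_ < X)%N]card_ord -cardsT; apply/proper_card/properP.
by split; [exact: finset.subsetT | exists i; rewrite ?inE // eqxx andbF].
Qed.

Definition order_rank (i : 'I_n) : 'I_n := Ordinal (order_rank_lt i).

Lemma order_rankE (i j : 'I_n) : Omega i j = (order_rank i <= order_rank j)%N.
Proof.
have [refl tr asym tot] := hOmega.
have mono u v : Omega u v -> u != v -> (order_rank u < order_rank v)%N.
  move=> uv ne; apply/proper_card/properP; split.
    apply/fintype.subsetP => k; rewrite !inE => /andP[ku kneu]; rewrite (tr _ _ _ ku uv) /=.
    by apply: contra kneu => /eqP kv; apply/eqP/asym; rewrite ku kv uv.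
  by exists u; rewrite ?inE ?uv ?ne // eqxx andbF.
have [->|ne] := eqVneq i j; first by rewrite refl leqnn.
case/orP: (tot i j) => ij.
  by rewrite ij ltnW // mono.
rewrite [RHS]leqNgt mono //= 1?eq_sym //.
by apply: contraNF ne => ji; apply/eqP/asym; rewrite ij ji.
Qed.

Lemma order_rank_inj : injective order_rank.
Proof.
have [_ _ asym _] := hOmega.
by move=> i j E; apply: asym; rewrite !order_rankE E leqnn.
Qed.

(** This makes the position of a vertex among the branch points independent of the
    cover. *)
Lemma order_rank_unique (s : 'I_n -> 'I_n) :
  (forall i j, Omega i j = (s i <= s j)%N) -> s =1 order_rank.
Proof.
have [refl _ asym _] := hOmega.
move=> sE i; have s_inj : injective s.
  by move=> u v E; apply: asym; rewrite !sE E leqnn.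
apply: val_inj; rewrite /= /order_rank_nat.
have -> : [set j | Omega j i && (j != i)]%SET = s @^-1: [set l : 'I_n | (l < s i)%N]%SET.
  apply/setP => j; rewrite !inE sE ltn_neqAle andbC; congr (~~ _ && _).
  by rewrite -(inj_eq s_inj).
rewrite on_card_preimset; last by apply: onW_bij; exact: injF_bij.
by rewrite -sum1dep_card -(big_ord_widen _ (fun=> 1%N)) ?sum1_card ?card_ord // ltnW.
Qed.

End OrderRank.

(** * Products of terms *)

Section TermProducts.

Lemma coef_tuple_prod g (t : term_tuple g) :
  coef (tuple_prod t) = (\prod_k coef (t k).2)%N.
Proof. by rewrite /tuple_prod (big_morph (@coef _) (fun _ _ => erefl) erefl). Qed.

Lemma expo_tuple_prod g (t : term_tuple g) i :
  expo (tuple_prod t) i = \sum_k expo (t k).2 i.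
Proof.
rewrite /tuple_prod (big_morph (fun T => expo T i) (id1 := 0) (op1 := +%R)) //.
  by move=> S T /=; rewrite ffunE.
by rewrite /= ffunE.
Qed.

Lemma edge_term_inj n (w w' : nat) (i j i' j' : 'I_n) : (0 < w)%N -> i != j ->
  edge_term w i j = edge_term w' i' j' -> [/\ w = w', i = i' & j = j'].
Proof.
move=> w0 ij; have ji : (j == i) = false by rewrite eq_sym; exact/negbTE.
case=> <- /ffunP E.
move: (E i) (E j); rewrite !ffunE !eqxx ji (negbTE ij).
case: (i =P i') => [<-|_]; case: (j =P j') => [<-|_] //;
  by do 2 case: (_ == _); move=> ? ?; exfalso; lia.
Qed.

End TermProducts.

(** * Balancing *)

Section Balancing.
Variables (R : realType) (L : R) (C : tropical_curve R) (f : cpoint C -> circle L).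

Definition net_slope (v : vertex C) : int :=
  \sum_(h | flag_at C h == v) ray_slope f h.

(** The balancing condition compares the rays on the two sides; written with
    signed slopes it is the vanishing of a sum. *)
Lemma balancedP : balanced f <-> forall v, net_slope v = 0.
Proof.
have E v : net_slope v =
    (\sum_(h | (flag_at C h == v) && (0 < ray_slope f h)%R) weight f h.1)%N%:Z -
    (\sum_(h | (flag_at C h == v) && (ray_slope f h < 0)%R) weight f h.1)%N%:Z.
  rewrite /net_slope !big_mkcondr /= !(big_morph Posz PoszD (erefl 0%:Z)) -sumrB.
  apply: eq_bigr => h _; rewrite /weight /ray_slope.
  by case: (h.2); case: ltrgt0P => s0 /=; rewrite ?subr0 ?sub0r; lia.
split=> [bal v|bal v]; first by rewrite E bal subrr.
by have := bal v; rewrite E => /eqP; rewrite subr_eq0 => /eqP[].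
Qed.

Lemma net_slopeE (v : vertex C) : net_slope v =
  \sum_e slope f e * ((v == endp C e false)%:R - (v == endp C e true)%:R).
Proof.
rewrite /net_slope big_mkcond -(pair_bigA _ (fun e b =>
  if flag_at C (e, b) == v then ray_slope f (e, b) else 0)) /=.
apply: eq_bigr => e _; rewrite big_bool /flag_at /ray_slope /= ![_ == v]eq_sym.
by case: eqP; case: eqP => _ _ /=; ring.
Qed.

(** At a vertex with a loop the two ends of the loop cancel in the balancing
    condition, so that the third ray is contracted. *)
Lemma balanced_loopless : (forall e, affine_with_slope f e (slope f e)) ->
  balanced f -> injective (fun v => f (vpoint C v)) ->
  forall e, endp C e false != endp C e true.
Proof.
move=> aff /balancedP bal f_inj e; apply/eqP => eE.
set v := endp C e false in eE.
have := cgraph_trivalent v; set S := [set h | _]%SET => S3.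
have inS b : (e, b) \in S by rewrite inE /flag_at; case: b => /=; rewrite -?eE.
have T1 : #|S :\ (e, false) :\ (e, true)|%SET == 1%N.
  have := cardsD1 (e, false) S; rewrite inS S3.
  rewrite (cardsD1 (e, true) (S :\ (e, false))%SET).
  rewrite in_setD1 inS xpair_eqE eqxx /= => E3; apply/eqP; lia.
have [h hE] := cards1P T1.
have hS : (h \in S) && (h.1 != e).
  have : h \in (S :\ (e, false) :\ (e, true))%SET by rewrite hE inE.
  rewrite !inE => /and3P[h1 h2 ->] /=; apply/eqP => he.
  by move: h1 h2; rewrite -he; case: (h) => ? [] /=; rewrite eqxx.
case/andP: hS => hS he.
have h0 : slope f h.1 = 0.
  have := bal v; rewrite /net_slope (bigD1 (e, false)) /=; last first.
    by have := inS false; rewrite inE.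
  rewrite (bigD1 (e, true)) /=; last first.
    by have := inS true; rewrite inE => ->; rewrite xpair_eqE andbF.
  rewrite (big_pred1 h) => [|k]; last first.
    have := congr1 (fun X : {set _} => k \in X) hE; rewrite !inE => <-.
    by rewrite andbC; congr (_ && _); rewrite andbC.
  by rewrite /ray_slope /=; case: (h.2); lia.
have [c cE] := aff h.1; rewrite h0 in cE.
have hl := len_gt0 h.1.
have hloop : endp C h.1 false = endp C h.1 true.
  apply: f_inj; rewrite -epoint_left -epoint_right !cE ?lexx ?(ltW hl) //.
  by rewrite mulr0z !mul0r.
have : (h.1, ~~ h.2) \in (S :\ (e, false) :\ (e, true))%SET.
  move: hS; rewrite !inE !xpair_eqE (negbTE he) /= /flag_at /=.
  by case: (h.2) => /=; rewrite hloop.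
by rewrite hE inE; case: (h) => ? [] /=; rewrite xpair_eqE eqxx.
Qed.

End Balancing.

(** * Labeled covers *)

Section CoverIso.
Variables (R : realType) (L : R) (g : nat) (Gamma : feynman_graph g).
Implicit Types c : labeled_cover L Gamma.

Lemma cover_iso_refl c : cover_iso c c.
Proof.
exists id; split=> //; last by move=> k; rewrite image_id.
by split=> //; exists id.
Qed.

Lemma cover_iso_sym c c' : cover_iso c c' -> cover_iso c' c.
Proof.
case=> phi [[[psi phiK psiK] ball_phi] f_phi v_phi e_phi].
exists psi; split.
- split; first by exists phi.
  by move=> x y r; rewrite -ball_phi !psiK.
- by move=> x; rewrite -f_phi psiK.
- by move=> i; rewrite -v_phi phiK.
- move=> k; rewrite -e_phi image_comp.
  by rewrite (_ : psi \o phi = id) ?image_id //; apply/funext => x /=; rewrite phiK.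
Qed.

Lemma cover_iso_trans c c' c'' :
  cover_iso c c' -> cover_iso c' c'' -> cover_iso c c''.
Proof.
case=> phi [[bij_phi ball_phi] f_phi v_phi e_phi].
case=> psi [[bij_psi ball_psi] f_psi v_psi e_psi].
exists (psi \o phi); split.
- split; first exact: bij_comp.
  by move=> x y r; rewrite /= ball_psi ball_phi.
- by move=> x; rewrite /= f_psi f_phi.
- by move=> i; rewrite /= v_phi v_psi.
- by move=> k; rewrite -image_comp e_phi e_psi.
Qed.

Lemma eq_iso_class c c' : cover_iso c c' -> iso_class c = iso_class c'.
Proof.
move=> cc'; apply/seteqP; split=> d /=; last exact: cover_iso_trans cc'.
exact: cover_iso_trans (cover_iso_sym cc').
Qed.

Lemma xlab_onto c (v : vertex (source c)) : exists i, xlab c i = v.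
Proof. by case: (xlab_bij c) => h _ hK; exists (h v). Qed.

Definition vertex_label c v := sval (cid (xlab_onto (c := c) v)).

Lemma vertex_labelK c v : xlab c (vertex_label v) = v.
Proof. by rewrite /vertex_label; case: cid. Qed.

Lemma xlabK c : cancel (xlab c) (@vertex_label c).
Proof. by move=> i; apply: (bij_inj (xlab_bij c)); rewrite vertex_labelK. Qed.

(** The end of [q_k] from which the image of [q_k] runs clockwise. *)
Definition tail_end c k : bool := slope (cmap c) (qlab c k) < 0.
Definition tail c k := vertex_label (endp (source c) (qlab c k) (tail_end c k)).
Definition head c k := vertex_label (endp (source c) (qlab c k) (~~ tail_end c k)).

Definition cover_tuple (a : 'I_(3 * g - 3) -> nat) c : term_tuple g :=
  [ffun k => (a k, edge_term (edge_weight c k) (tail c k) (head c k))].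

Lemma coef_cover_tuple a c k : coef (cover_tuple a c k).2 = edge_weight c k.
Proof. by rewrite ffunE. Qed.

Lemma joins_tail_head c k : joins Gamma k (tail c k) (head c k).
Proof.
rewrite -(lab_joins c) /tail /head !vertex_labelK.
by apply/existsP; exists (tail_end c k); rewrite !eqxx.
Qed.

Lemma joinsE c k i j : joins Gamma k i j ->
  (i = tail c k /\ j = head c k) \/ (i = head c k /\ j = tail c k).
Proof.
rewrite -(lab_joins c) => /existsP[b /andP[/eqP bi /eqP bj]].
rewrite /tail /head.
by case: (tail_end c k) b bi bj => -[] /= -> ->; rewrite !xlabK; [left|right|right|left].
Qed.

(** The reason why tuples with constant product correspond to balanced maps. *)
Lemma expo_cover_tuple a c i :
  expo (tuple_prod (cover_tuple a c)) i = 2 * net_slope (cmap c) (xlab c i).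
Proof.
rewrite expo_tuple_prod net_slopeE (reindex (qlab c)) /=; last first.
  by apply: onW_bij; exact: qlab_bij.
rewrite mulr_sumr; apply: eq_bigr => k _; rewrite !ffunE /=.
have labE v : (i == vertex_label v) = (xlab c i == v).
  by rewrite -(inj_eq (bij_inj (xlab_bij c))) vertex_labelK.
rewrite /tail /head !labE /edge_weight /weight /tail_end.
by case: ltrP => s0 /=; lia.
Qed.

End CoverIso.

(** * Covers contributing to the count *)

Section Contributing.
Variables (R : realType) (L : R).
Hypothesis hL : 0 < L.
Variables (g : nat) (Gamma : feynman_graph g).
Variables (Omega : rel 'I_(2 * g - 2)) (a : 'I_(3 * g - 3) -> nat).
Hypothesis hOmega : is_total_order Omega.
Variables (p0 : circle L) (p : 'I_(2 * g - 2) -> circle L).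
Hypothesis hp : clockwise_ordered p0 p.
Implicit Types c : labeled_cover L Gamma.

(** By [contributes_vertex] this is the coordinate of the image of [x_i] in every
    contributing cover. *)
Definition pos i : R := cut_coord p0 (p (order_rank Omega i)).

Lemma branch_coord_le i j : (cut_coord p0 (p i) <= cut_coord p0 (p j)) = (i <= j)%N.
Proof.
case: (ltngtP i j) => [ij|ji|/val_inj ->]; last by rewrite lexx.
  by rewrite ltW // (hp.2 _ _ ij).
by apply/negbTE; rewrite -ltNge (hp.2 _ _ ji).
Qed.

Lemma pos_le i j : (pos i <= pos j) = Omega i j.
Proof. by rewrite /pos branch_coord_le -order_rankE. Qed.

Lemma pos_inj : injective pos.
Proof.
have [_ _ asym _] := hOmega.
by move=> i j E; apply: asym; rewrite -!pos_le E lexx.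
Qed.

Lemma pos_itv i : 0 < pos i < L.
Proof.
have /andP[h0 h1] := cut_coord_itv hL p0 (p (order_rank Omega i)).
rewrite h1 andbT lt_neqAle h0 andbT eq_sym; apply/eqP => E.
by apply: (hp.1 (order_rank Omega i)); apply: (cut_coord_inj (p0 := p0)); rewrite cut_coord_base.
Qed.

Lemma posK i : circle_proj L (repr p0 + pos i) = p (order_rank Omega i).
Proof. exact: cut_coordK. Qed.

Section OneCover.
Variable c : labeled_cover L Gamma.
Hypothesis hc : contributes a Omega p0 p c.

(** The order of the vertices and the set of branch points determine the branch
    point below each vertex. *)
Lemma contributes_vertex i :
  cmap c (vpoint (source c) (xlab c i)) = circle_proj L (repr p0 + pos i).
Proof.
case: hc => _ range_c _ order_c.
have ex j : exists l, p l = cmap c (vpoint (source c) (xlab c j)).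
  have : range p (cmap c (vpoint (source c) (xlab c j))).
    by rewrite -range_c; exists (xlab c j).
  by case=> l _ lE; exists l.
have [s sE] := choice ex.
rewrite posK -sE; congr p; apply: order_rank_unique => // j l.
by rewrite order_c -!sE branch_coord_le.
Qed.

Let f_inj : injective (fun v => cmap c (vpoint (source c) v)).
Proof.
move=> u v; rewrite -(vertex_labelK u) -(vertex_labelK v) /= !contributes_vertex.
rewrite !posK => E; congr (xlab c _); apply: pos_inj.
by rewrite /pos E.
Qed.

Let aff e : affine_with_slope (cmap c) e (slope (cmap c) e).
Proof. by case: (cmap_cover c) => _ _ h _; apply: slope_affine. Qed.

Lemma contributes_loopless e : endp (source c) e false != endp (source c) e true.
Proof. by apply: balanced_loopless e => //; case: (cmap_cover c). Qed.

Lemma edge_weight_gt0 k : (0 < edge_weight c k)%N.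
Proof.
rewrite absz_gt0; apply/eqP => s0.
have [d dE] := aff (qlab c k); rewrite s0 in dE.
have l0 := len_gt0 (qlab c k).
have /eqP := contributes_loopless (qlab c k); apply; apply: f_inj.
rewrite -epoint_left -epoint_right !dE ?lexx ?(ltW l0) //.
by rewrite mulr0z !mul0r.
Qed.

Lemma tail_neq_head k : tail c k != head c k.
Proof.
have := contributes_loopless (qlab c k); rewrite /tail /head.
rewrite -(inj_eq (bij_inj (xlab_bij c))) !vertex_labelK.
by case: tail_end; rewrite //= eq_sym.
Qed.

Lemma contributes_climbs k : climbs (cmap c) (qlab c k) (tail_end c k)
  (edge_weight c k) (repr p0 + pos (tail c k)).
Proof.
have [A h] := affine_climbs (aff (qlab c k)).
by apply: climbs_shift (h) _; rewrite -contributes_vertex vertex_labelK.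
Qed.

(** The turns of an edge are counted by its points over the base point. *)
Lemma contributes_turns k : exists2 N : nat,
  (edge_weight c k)%:R * len (qlab c k) =
    pos (head c k) - pos (tail c k) + N%:R * L
  & a k = (N * edge_weight c k)%N.
Proof.
have l0 := len_gt0 (qlab c k); have w0 := edge_weight_gt0 k.
have : cmap c (opoint (qlab c k) (tail_end c k) (len (qlab c k))) =
       circle_proj L (repr p0 + pos (head c k)).
  by rewrite opoint_end -contributes_vertex vertex_labelK.
rewrite contributes_climbs ?lexx ?(ltW l0) // => /circle_projP[N NE].
have lE : (edge_weight c k)%:R * len (qlab c k) =
    pos (head c k) - pos (tail c k) + N%:~R * L by rewrite -NE; ring.
case: hc => _ _ count_c _.
have /andP[t0 tL] := pos_itv (tail c k); have /andP[h0 h1] := pos_itv (head c k).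
have := edge_count_turns hL w0 (@contributes_climbs k) lE (z := 0).
rewrite (ltW t0) tL (ltW h0) h1 lexx hL (lt_eqF t0) (lt_eqF h0) addr0.
rewrite [circle_proj _ _]reprK !ltNge (ltW t0) (ltW h0) subr0 addr0.
move=> /(_ isT isT isT isT isT) cN.
exists (edge_count (cmap c) (qlab c k) p0); first by rewrite lE -cN ?pmulrn.
by rewrite -count_c.
Qed.

Lemma contributes_edge_count k z N :
  (edge_weight c k)%:R * len (qlab c k) =
    pos (head c k) - pos (tail c k) + N%:R * L ->
  0 <= z < L -> z != pos (tail c k) -> z != pos (head c k) ->
  (edge_count (cmap c) (qlab c k) (circle_proj L (repr p0 + z)))%:Z =
  N%:Z + (pos (tail c k) < z)%R%:Z - (pos (head c k) < z)%R%:Z.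
Proof.
move=> lE hz zt zh.
have /andP[t0 tL] := pos_itv (tail c k); have /andP[h0 h1] := pos_itv (head c k).
apply: (edge_count_turns hL (edge_weight_gt0 k) (@contributes_climbs k)) => //.
- by rewrite ltW.
- by rewrite ltW.
Qed.

Lemma cover_tuple_mem : tuples Gamma a Omega (cover_tuple a c).
Proof.
split=> k; first by rewrite ffunE.
  rewrite ffunE; exists (tail c k), (head c k), (edge_weight c k).
  have [N NE aE] := contributes_turns k.
  split=> //; [exact: joins_tail_head | exact: edge_weight_gt0 |].
  case: ifP => [/eqP a0|_]; last by rewrite aE dvdn_mull.
  rewrite tail_neq_head andbT -pos_le ltW //.
  have N0 : N = 0%N by move: (edge_weight_gt0 k) aE; rewrite a0; nia.
  have : 0 < (edge_weight c k)%:R * len (qlab c k).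
    by rewrite mulr_gt0 ?ltr0n ?edge_weight_gt0 ?len_gt0.
  by rewrite NE N0; lra.
rewrite expo_cover_tuple; case: (cmap_cover c) => _ _ _ /balancedP ->.
by rewrite mulr0.
Qed.

Lemma tuple_prod_cover_tuple : tuple_prod (cover_tuple a c) = Term (multiplicity c) 0.
Proof.
have [_ _ e0] := cover_tuple_mem; move: e0.
have := coef_tuple_prod (cover_tuple a c).
case: (tuple_prod _) => w x /= -> x0; congr Term.
  by apply: eq_bigr => k _; rewrite coef_cover_tuple.
by apply/ffunP => i; rewrite x0 ffunE.
Qed.

End OneCover.

(** The weights are recovered from distances near the midpoint of an edge, and
    the direction of an edge from the number of its points above a point that
    separates the images of its ends. *)
Lemma cover_tuple_iso c c' : contributes a Omega p0 p c ->
  contributes a Omega p0 p c' -> cover_iso c c' -> cover_tuple a c = cover_tuple a c'.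
Proof.
move=> hc hc' [phi [iso f_phi v_phi e_phi]]; apply/ffunP => k; rewrite !ffunE.
have wE : edge_weight c k = edge_weight c' k.
  apply: (isometry_speed hL iso f_phi (e_phi k)).
  - by move=> v'; exists (xlab c (vertex_label v')); rewrite v_phi vertex_labelK.
  - by apply: slope_affine => //; case: (cmap_cover c).
  - by apply: slope_affine => //; case: (cmap_cover c').
have [[tE hE]|[tE hE]] := joinsE c' (joins_tail_head c k).
  by rewrite wE tE hE.
have [N NE aE] := contributes_turns hc k.
have [N' NE' aE'] := contributes_turns hc' k.
have NN' : N = N'.
  by apply/eqP; rewrite -(eqn_pmul2r (edge_weight_gt0 hc k)) -aE wE -aE'.
have ne := tail_neq_head hc k.
have pne : pos (tail c k) != pos (head c k) by rewrite (inj_eq pos_inj).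
have /andP[t0 tL] := pos_itv (tail c k); have /andP[h0 h1] := pos_itv (head c k).
(* the midpoint separates the images of the two ends *)
pose z := (pos (tail c k) + pos (head c k)) / 2.
have hz : 0 <= z < L by rewrite /z; lra.
have zt : z != pos (tail c k).
  by apply: contraNneq pne => zE; apply/eqP; move: zE; rewrite /z; lra.
have zh : z != pos (head c k).
  by apply: contraNneq pne => zE; apply/eqP; move: zE; rewrite /z; lra.
have := contributes_edge_count hc NE hz zt zh.
move: (contributes_edge_count hc' NE' hz).
rewrite -tE -hE => /(_ zh zt).
rewrite (isometry_edge_count iso f_phi (e_phi k)) -NN' => -> cE.
have [th|ht|/pos_inj/eqP] := ltrgtP (pos (tail c k)) (pos (head c k)); last first.
- by rewrite (negbTE ne).
- have hz1 : (pos (head c k) < z) = true by rewrite /z; lra.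
  have tz1 : (pos (tail c k) < z) = false by apply/negbTE; rewrite -leNgt /z; lra.
  by move: cE; rewrite hz1 tz1; clear; lia.
- have hz1 : (pos (head c k) < z) = false by apply/negbTE; rewrite -leNgt /z; lra.
  have tz1 : (pos (tail c k) < z) = true by rewrite /z; lra.
  by move: cE; rewrite hz1 tz1; clear; lia.
Qed.

(** Equal tuples give equal edge lengths; the isometry matches the edges with the
    same label so that the clockwise directions agree. *)
Lemma cover_tuple_inj c c' : contributes a Omega p0 p c ->
  contributes a Omega p0 p c' -> cover_tuple a c = cover_tuple a c' -> cover_iso c c'.
Proof.
move=> hc hc' /ffunP tE.
have E k : [/\ edge_weight c k = edge_weight c' k, tail c k = tail c' k
             & head c k = head c' k].
  have := congr1 snd (tE k); rewrite !ffunE.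
  by apply: edge_term_inj; [exact: edge_weight_gt0 hc k | exact: tail_neq_head].
have lenE k : len (qlab c' k) = len (qlab c k).
  have [wE htE hhE] := E k.
  have [N NE aE] := contributes_turns hc k.
  have [N' NE' aE'] := contributes_turns hc' k.
  have NN' : N = N'.
    by apply/eqP; rewrite -(eqn_pmul2r (edge_weight_gt0 hc k)) -aE wE -aE'.
  have w0 : (edge_weight c k)%:R != 0 :> R by rewrite pnatr_eq0 -lt0n edge_weight_gt0.
  by apply: (mulfI w0); rewrite NE [in LHS]wE NE' NN' htE hhE.
have [ylab qlabK ylabK] := qlab_bij c.
pose xv v := xlab c' (vertex_label (c := c) v).
pose xe e := qlab c' (ylab e).
pose flip e := tail_end c (ylab e) (+) tail_end c' (ylab e).
have xv_bij : bijective xv.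
  exists (fun v => xlab c (vertex_label v)) => v; rewrite /xv xlabK vertex_labelK //.
have xe_bij : bijective xe.
  by apply: bij_comp (qlab_bij c') _; exists (qlab c).
have len_xe e : len (xe e) = len e by rewrite /xe lenE ylabK.
have endp_xe e b : endp (source c') (xe e) (b (+) flip e) = xv (endp (source c) e b).
  rewrite -(ylabK e) /xe /flip !qlabK; set k := ylab e; have [_ htE hhE] := E k.
  have [->|ne] := eqVneq b (tail_end c k).
    by rewrite addKb /xv -/(tail c k) htE vertex_labelK.
  have -> : b = ~~ tail_end c k by move: ne; case: (b); case: tail_end.
  rewrite addNb addKb.
  by rewrite /xv -/(head c k) hhE vertex_labelK.
pose phi := graph_map xv xe flip.
have phi_o e u : 0 <= u <= len e ->
    phi (opoint e (tail_end c (ylab e)) u) = opoint (xe e) (tail_end c' (ylab e)) u.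
  move=> hu; have lx := len_xe e.
  rewrite /opoint /phi (graph_map_epoint len_xe endp_xe); last by case: tail_end; lra.
  by rewrite /flip /opoint lx; case: tail_end; case: tail_end => //=; rewrite subKr.
exists phi; split.
- exact: graph_map_isometry.
- move=> x; have [[v ->]|[e [t [ht ->]]]] := cpointP x.
    by rewrite /phi /= -(vertex_labelK v) /xv xlabK !contributes_vertex.
  rewrite (epointE e (tail_end c (ylab e))).
  set u := if _ then _ else _.
  have hu : 0 <= u <= len e by rewrite /u; case: tail_end; lra.
  have [wE htE _] := E (ylab e).
  rewrite phi_o // (contributes_climbs hc') ?len_xe //.
  rewrite -{3}(ylabK e) (contributes_climbs hc) ?ylabK //.
  by rewrite wE htE.
- by move=> i; rewrite /phi /= /xv xlabK.
- move=> k; apply/seteqP; split=> x /=.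
    case=> _ [t /= ht <-] <-; rewrite /phi (graph_map_epoint len_xe endp_xe) //.
    rewrite /xe qlabK /opoint; exists (if flip (qlab c k) then len (qlab c' k) - t else t) => //.
    by rewrite /= lenE; case: (flip _); lra.
  case=> t /= ht <-.
  exists (opoint (qlab c k) (flip (qlab c k)) t).
    rewrite /opoint; exists (if flip (qlab c k) then len (qlab c k) - t else t) => //=.
    by rewrite -lenE; case: (flip _); lra.
  rewrite /opoint /phi (graph_map_epoint len_xe endp_xe); last by rewrite -lenE; case: (flip _); lra.
  by rewrite /opoint /xe qlabK lenE; case: (flip _) => //; rewrite subKr.
Qed.

End Contributing.

(** * The cover defined by a tuple *)

Section CoverOfTuple.
Variables (R : realType) (L : R).
Hypothesis hL : 0 < L.
Variables (g : nat) (Gamma : feynman_graph g).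
Variables (Omega : rel 'I_(2 * g - 2)) (a : 'I_(3 * g - 3) -> nat).
Hypothesis hOmega : is_total_order Omega.
Variables (p0 : circle L) (p : 'I_(2 * g - 2) -> circle L).
Hypothesis hp : clockwise_ordered p0 p.
Variables (w : 'I_(3 * g - 3) -> nat) (b : 'I_(3 * g - 3) -> bool).

Let tl k := endp Gamma k (b k).
Let hd k := endp Gamma k (~~ b k).

Hypothesis w_gt0 : forall k, (0 < w k)%N.
Hypothesis w_turns : forall k,
  if a k == 0%N then Omega (tl k) (hd k) && (tl k != hd k) else (w k %| a k)%N.
Hypothesis w_balanced : forall i,
  \sum_k (w k)%:Z * ((i == tl k)%:R - (i == hd k)%:R) = 0.

Let ps := pos Omega p0 p.
Let ps_itv i : 0 < ps i < L := pos_itv hL Omega hp i.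

(** The length that makes [q_k] run at speed [w_k] from its tail to its head
    with [a_k / w_k] full turns. *)
Definition model_len k : R := (ps (hd k) - ps (tl k) + (a k %/ w k)%:R * L) / (w k)%:R.

Lemma w_model_len k :
  (w k)%:R * model_len k = ps (hd k) - ps (tl k) + (a k %/ w k)%:R * L.
Proof. by rewrite mulrC divfK // pnatr_eq0 -lt0n w_gt0. Qed.

Lemma turns_times_w k : (a k %/ w k * w k)%N = a k.
Proof. by have := w_turns k; case: eqP => [->|_ /divnK //]; rewrite div0n mul0n. Qed.

Lemma model_len_gt0 k : 0 < model_len k.
Proof.
rewrite divr_gt0 ?ltr0n ?w_gt0 //.
have /andP[t0 tL] := ps_itv (tl k); have /andP[h0 h1] := ps_itv (hd k).
have := w_turns k; case: eqP => [->|/eqP ak] hk.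
  rewrite div0n mul0r addr0 subr_gt0 lt_neqAle pos_le // andbC.
  by rewrite (inj_eq (pos_inj hOmega hp)).
have : 1 * L <= (a k %/ w k)%:R * L.
  by rewrite ler_pM2r // ler1n divn_gt0 // dvdn_leq // lt0n.
by lra.
Qed.

Definition model_curve : tropical_curve R :=
  TropicalCurve model_len_gt0 (@fgraph_connected _ Gamma)
    (@fgraph_trivalent _ Gamma).

Definition model_map (x : cpoint model_curve) : circle L :=
  match x with
  | inl v => circle_proj L (repr p0 + ps v)
  | inr q => let: (k, t) := val q in
      circle_proj L (repr p0 + ps (tl k) +
        (w k)%:R * (if b k then model_len k - t else t))
  end.

Lemma model_climbs (k : edge model_curve) :
  climbs model_map k (b k) (w k) (repr p0 + ps (tl k)).
Proof.
move=> u hu; have l0 : 0 < len k := len_gt0 k.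
have [->|u0] := eqVneq u 0; first by rewrite opoint_start mulr0 addr0.
have [->|ul] := eqVneq u (len k).
  rewrite opoint_end /= w_model_len; apply/circle_projP.
  exists (- (a k %/ w k)%N%:Z); rewrite mulrNz -pmulrn /hd; ring.
have hi : 0 < u < len k by rewrite !lt_neqAle eq_sym u0 ul; lra.
rewrite /opoint.
have hi' : 0 < (if b k then len k - u else u) < len k by case: (b k); lra.
by rewrite (epoint_interior hi') /=; case: (b k) => //; rewrite subKr.
Qed.

Lemma model_slope (k : edge model_curve) :
  slope model_map k = if b k then - (w k)%:Z else (w k)%:Z.
Proof. by have := climbs_slope hL (@model_climbs k). Qed.

Lemma model_tail_end (k : edge model_curve) : (slope model_map k < 0) = b k.
Proof. by rewrite model_slope; have := w_gt0 k; case: (b k); lia. Qed.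

Lemma model_balanced : balanced model_map.
Proof.
apply/balancedP => v; rewrite net_slopeE -[RHS](w_balanced v).
apply: eq_bigr => k _; rewrite model_slope /tl /hd.
by case: (b k) => //=; ring.
Qed.

Hypothesis g_gt1 : (1 < g)%N.

Lemma model_cover : tropical_cover model_map.
Proof.
have aff (e : edge model_curve) : exists s, affine_with_slope model_map e s.
  by eexists; apply: climbs_affine; exact: (@model_climbs e).
split=> //; last exact: model_balanced.
  exact: edgewise_affine_continuous.
have n0 : (0 < 2 * g - 2)%N by lia.
have n1 : (1 < 2 * g - 2)%N by lia.
exists (vpoint model_curve (Ordinal n0)), (vpoint model_curve (Ordinal n1)).
rewrite /= !posK => E.
suff : Ordinal n0 = Ordinal n1 by case.
by apply: (pos_inj hOmega hp); rewrite /pos E.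
Qed.

Definition model : labeled_cover L Gamma :=
  @LabeledCover R L g Gamma model_curve model_map model_cover id id
    (@Bijective _ _ id id (fun _ => erefl) (fun _ => erefl))
    (@Bijective _ _ id id (fun _ => erefl) (fun _ => erefl))
    (fun _ _ _ => erefl).

Lemma model_edge_count (k : edge model_curve) z :
  0 <= z < L -> z != ps (tl k) -> z != ps (hd k) ->
  (edge_count model_map k (circle_proj L (repr p0 + z)))%:Z =
  (a k %/ w k)%N%:Z + (ps (tl k) < z)%R%:Z - (ps (hd k) < z)%R%:Z.
Proof.
move=> hz zt zh.
have /andP[t0 tL] := ps_itv (tl k); have /andP[h0 h1] := ps_itv (hd k).
have lE : (w k)%:R * len k = ps (hd k) - ps (tl k) + (a k %/ w k)%N%:Z%:~R * L.
  by rewrite -pmulrn; exact: w_model_len.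
by apply: (edge_count_turns hL (w_gt0 k) (@model_climbs k) lE) => //; rewrite ltW.
Qed.

(** Moving the point of [E] across the image of a vertex changes the number of
    weighted preimages by the balancing defect of that vertex. *)
Lemma model_degree : has_degree model_map (\sum_k a k)%N.
Proof.
move=> x hx; set z := cut_coord p0 x.
have hz : 0 <= z < L by exact: cut_coord_itv.
have zv v : z != ps v.
  by apply/eqP => E; apply: (hx v); rewrite /= -E cut_coordK.
suff E : (\sum_(e : edge model_curve) weight model_map e * edge_count model_map e x)%N%:Z
    = (\sum_k a k)%N%:Z by case: E.
rewrite !(big_morph Posz PoszD (erefl 0%:Z)).
have termE (k : edge model_curve) :
    (weight model_map k * edge_count model_map k x)%N%:Z =
    (a k)%:Z + (w k)%:Z * ((ps (tl k) < z)%R%:Z - (ps (hd k) < z)%R%:Z).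
  rewrite (climbs_weight hL (@model_climbs k)) PoszM.
  have -> : x = circle_proj L (repr p0 + z) by rewrite cut_coordK.
  by rewrite model_edge_count // -addrA mulrDr -PoszM mulnC turns_times_w.
rewrite (eq_bigr _ (fun k _ => termE k)).
rewrite big_split /= -[RHS]addr0; congr (_ + _).
(* the corrections, grouped by vertices, are the exponents that vanish *)
have -> : 0 = \sum_v (ps v < z)%R%:Z *
    \sum_k (w k)%:Z * ((v == tl k)%:R - (v == hd k)%:R).
  by rewrite big1 // => v _; rewrite w_balanced mulr0.
under [RHS]eq_bigr do rewrite mulr_sumr.
rewrite exchange_big /=; apply: eq_bigr => k _.
under eq_bigr do rewrite mulrCA mulrBr.
rewrite -mulr_sumr sumrB; congr (_ * (_ - _)).
  by rewrite (bigD1 (tl k)) //= eqxx mulr1 big1 ?addr0 // => v /negbTE ->; rewrite mulr0.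
by rewrite (bigD1 (hd k)) //= eqxx mulr1 big1 ?addr0 // => v /negbTE ->; rewrite mulr0.
Qed.

Lemma model_contributes : contributes a Omega p0 p model.
Proof.
split.
- exact: model_degree.
- apply/seteqP; split=> x /= [v _ <-].
    by exists (order_rank Omega v); rewrite ?posK.
  have [h _ hK] := injF_bij (order_rank_inj hOmega).
  by exists (h v); rewrite //= posK hK.
- move=> k; rewrite /edge_weight /= (climbs_weight hL (@model_climbs k)).
  have /andP[t0 tL] := ps_itv (tl k); have /andP[h0 h1] := ps_itv (hd k).
  have := @model_edge_count k 0.
  rewrite lexx hL (lt_eqF t0) (lt_eqF h0) addr0 [circle_proj _ _]reprK.
  rewrite !ltNge (ltW t0) (ltW h0) subr0 addr0.
  by move=> /(_ isT isT isT)[->]; exact: turns_times_w.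
- by move=> i j; rewrite -(pos_le hOmega hp) /= !cut_coord_proj //;
    rewrite ltW ?(andP (ps_itv _)).1 ?(andP (ps_itv _)).2.
Qed.

Lemma model_cover_tuple :
  cover_tuple a model = [ffun k => (a k, edge_term (w k) (tl k) (hd k))].
Proof.
apply/ffunP => k; rewrite !ffunE; congr (_, edge_term _ _ _).
- by rewrite /edge_weight (climbs_weight hL (@model_climbs k)).
- by rewrite -[LHS]/(xlab model _) /tail vertex_labelK /tail_end /= model_tail_end.
- by rewrite -[LHS]/(xlab model _) /head vertex_labelK /tail_end /= model_tail_end.
Qed.

End CoverOfTuple.

Lemma cover_tuple_surj (R : realType) (L : R) (g : nat) (Gamma : feynman_graph g)
    (Omega : rel 'I_(2 * g - 2)) (a : 'I_(3 * g - 3) -> nat)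
    (p0 : circle L) (p : 'I_(2 * g - 2) -> circle L) :
  0 < L -> (1 < g)%N -> is_total_order Omega -> clockwise_ordered p0 p ->
  forall t, tuples Gamma a Omega t ->
  exists2 c : labeled_cover L Gamma, contributes a Omega p0 p c & cover_tuple a c = t.
Proof.
move=> hL hg hOmega hp t [t_a t_av t_0].
have ex k : exists wb : nat * bool,
    [/\ (t k).2 = edge_term wb.1 (endp Gamma k wb.2) (endp Gamma k (~~ wb.2)),
        (0 < wb.1)%N
      & if a k == 0%N then Omega (endp Gamma k wb.2) (endp Gamma k (~~ wb.2))
          && (endp Gamma k wb.2 != endp Gamma k (~~ wb.2))
        else (wb.1 %| a k)%N].
  have [i [j [w [/existsP[b /andP[/eqP <- /eqP <-]] tE w0 cond]]]] := t_av k.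
  by exists (w, b).
have [wb wbP] := choice ex.
pose w k := (wb k).1; pose b k := (wb k).2.
have w0 k : (0 < w k)%N by case: (wbP k).
have turns k : if a k == 0%N then
    Omega (endp Gamma k (b k)) (endp Gamma k (~~ b k)) &&
    (endp Gamma k (b k) != endp Gamma k (~~ b k)) else (w k %| a k)%N.
  by case: (wbP k).
have bal i : \sum_k (w k)%:Z *
    ((i == endp Gamma k (b k))%:R - (i == endp Gamma k (~~ b k))%:R) = 0.
  have := t_0 i; rewrite expo_tuple_prod => E.
  suff : 2 * (\sum_k (w k)%:Z *
    ((i == endp Gamma k (b k))%:R - (i == endp Gamma k (~~ b k))%:R)) = 0 :> int.
    by move/eqP; rewrite mulf_eq0 /= => /eqP.
  rewrite -[RHS]E mulr_sumr; apply: eq_bigr => k _.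
  by have [-> _ _] := wbP k; rewrite ffunE PoszM mulrA.
exists (model hL hOmega hp w0 turns bal hg); first exact: model_contributes.
rewrite model_cover_tuple; apply/ffunP => k; rewrite ffunE.
by have [tE _ _] := wbP k; have := t_a k; case: (t k) tE => ? ? /= -> ->.
Qed.

(** * The bijection *)

Theorem theorem2p30 (R : realType) (L : R) (hL : 0 < L)
    (g : nat) (hg : (1 < g)%N) (Gamma : feynman_graph g)
    (Omega : rel 'I_(2 * g - 2)) (hOmega : is_total_order Omega)
    (a : 'I_(3 * g - 3) -> nat)
    (p0 : circle L) (p : 'I_(2 * g - 2) -> circle L)
    (hp : clockwise_ordered p0 p) :
  exists Phi : set (labeled_cover L Gamma) -> term_tuple g,
    set_bij (contributing_covers Gamma a Omega p0 p) (tuples Gamma a Omega) Phi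
    /\ forall c : labeled_cover L Gamma, contributes a Omega p0 p c ->
         (forall k, coef (Phi (iso_class c) k).2 = edge_weight c k) /\
         tuple_prod (Phi (iso_class c)) = Term (multiplicity c) 0.
Proof.
(* a class of contributing covers is sent to the tuple of any contributing
   representative; the value on other sets is arbitrary *)
pose rep (A : set (labeled_cover L Gamma)) c := A c /\ contributes a Omega p0 p c.
pose Phi (A : set (labeled_cover L Gamma)) : term_tuple g :=
  if pselect (exists c, rep A c) is left e then cover_tuple a (sval (cid e))
  else [ffun => (0%N, term_one _)].
have PhiE c : contributes a Omega p0 p c -> Phi (iso_class c) = cover_tuple a c.
  move=> hc; rewrite /Phi; case: pselect => [e|[]]; last first.
    by exists c; split=> //; exact: cover_iso_refl.
  case: cid => c' [/= cc' hc'].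
  exact/esym/(cover_tuple_iso hL hOmega hp hc hc' cc').
exists Phi; split; last first.
  move=> c hc; rewrite PhiE //; split=> [k|]; first exact: coef_cover_tuple.
  exact: (tuple_prod_cover_tuple hL hOmega hp hc).
split.
- move=> _ [c hc <-]; rewrite PhiE //; exact: (cover_tuple_mem hL hOmega hp hc).
- move=> _ _ /set_mem[c hc <-] /set_mem[c' hc' <-]; rewrite !PhiE // => E.
  exact/eq_iso_class/(cover_tuple_inj hL hOmega hp hc hc' E).
- move=> t /(cover_tuple_surj hL hg hOmega hp)[c hc <-].
  by exists (iso_class c); [exists c | rewrite PhiE].
Qed.
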